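(* Let $(N_k)$ be a strictly increasing sequence of positive integers, let $a\colon\mathbb N\to\{-1,1\}$ be a sequence that satisfies the Chowla-Elliott conjecture for Cesàro averages along $(N_k)$, and let $b:=a\cdot f$, where $f\colon\mathbb N\to\mathbb U$ is a pretentious multiplicative function. Then $b$ also satisfies the Chowla-Elliott conjecture for Cesàro averages along $(N_k)$. The same holds with logarithmic averages in place of Cesàro averages throughout.
   Context: $\mathbb N=\{1,2,\ldots\}$, $\mathbb Z_+=\{0,1,2,\ldots\}$, $\mathbb P$ is the set of primes, $\mathbb U$ is the closed complex unit disc, $[N]=\{1,\ldots,N\}$. A function $f\colon\mathbb N\to\mathbb U$ is multiplicative if $f(mn)=f(m)f(n)$ whenever $(m,n)=1$. For multiplicative $f,g\colon\mathbb N\to\mathbb U$ let $\mathbb D^2(f,g)=\sum_{p\in\mathbb P}\frac1p\big(1-\mathrm{Re}(f(p)\overline{g(p)})\big)$ and write $f\sim g$ if $\mathbb D(f,g)<+\infty$. $f$ is pretentious if $f\sim n^{it}\cdot\chi$ for some $t\in\mathbb R$ and some primitive Dirichlet character $\chi$ (the constant $\chi=1$, with conductor $1$, is regarded as primitive). Write $\mathbb E_{n\in[N]}a(n)=\frac1N\sum_{n=1}^Na(n)$ (Cesàro) and $\mathbb E^{\log}_{n\in[N]}a(n)=\big(\sum_{n=1}^N\frac1n\big)^{-1}\sum_{n=1}^N\frac{a(n)}n$ (logarithmic). A sequence $a\colon\mathbb N\to\mathbb U$ satisfies the Chowla-Elliott conjecture for Cesàro averages along $(N_k)$ if $$\lim_{k\to\infty}\mathbb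 E_{n\in[N_k]}\,a^{\epsilon_1}(n+n_1)\cdots a^{\epsilon_\ell}(n+n_\ell)=0$$ for all $\ell\in\mathbb N$, distinct $n_1,\ldots,n_\ell\in\mathbb Z_+$, and all $\epsilon_1,\ldots,\epsilon_\ell\in\{-1,1\}$, where $a^{-1}:=\overline a$. For logarithmic averages replace $\mathbb E$ by $\mathbb E^{\log}$. *)

(* Defs.v *)
From HB Require Import structures.
From mathcomp Require Import all_boot all_order all_algebra.
From mathcomp Require Import complex.
From mathcomp Require Import all_classical all_reals all_analysis.
Set Implicit Arguments.
Unset Strict Implicit.
Unset Printing Implicit Defensive.
Import Order.TTheory GRing.Theory Num.Theory numFieldNormedType.Exports.
Local Open Scope classical_set_scope.
Local Open Scope ring_scope.
Local Open Scope complex_scope.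

(* Sequences on {1, 2, ...} are functions on nat whose value at 0 is never
   used, except that Dirichlet characters are genuinely defined at 0. *)

Definition disc_valued (R : realType) (f : nat -> R[i]) : Prop :=
  forall n, (0 < n)%N -> `|f n| <= 1.

Definition multiplicative_fun (R : realType) (f : nat -> R[i]) : Prop :=
  forall m n, (0 < m)%N -> (0 < n)%N -> coprime m n -> f (m * n)%N = f m * f n.

Definition dirichlet_character (R : realType) (q : nat) (chi : nat -> R[i])
  : Prop :=
  [/\ (0 < q)%N,
      forall n, chi (n + q)%N = chi n,
      forall m n, chi (m * n)%N = chi m * chi n &
      forall n, (chi n != 0) = coprime n q].

(* Primitive: not induced by a character of a smaller modulus. For q = 1 the
   condition is vacuous, so the constant 1 is primitive of conductor 1. *)
Definition primitive_character (R : realType) (q : nat) (chi : nat -> R[i])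
  : Prop :=
  dirichlet_character q chi /\
  forall (d : nat) (psi : nat -> R[i]),
    (d %| q)%N -> (d < q)%N -> dirichlet_character d psi ->
    ~ (forall n, coprime n q -> chi n = psi n).

(* n^{it} = exp(i t log n) *)
Definition nat_pow_it (R : realType) (t : R) (n : nat) : R[i] :=
  cos (t * ln n%:R) +i* sin (t * ln n%:R).

Definition pretdist2 (R : realType) (f g : nat -> R[i]) : \bar R :=
  (\sum_(0 <= p <oo | prime p)
     (p%:R^-1 * (1 - complex.Re (f p * (g p)^*)))%:E)%E.

Definition pretends (R : realType) (f g : nat -> R[i]) : Prop :=
  (pretdist2 f g < +oo)%E.

Definition pretentious (R : realType) (f : nat -> R[i]) : Prop :=
  exists (t : R) (q : nat) (chi : nat -> R[i]),
    primitive_character q chi /\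
    pretends f (fun n => nat_pow_it t n * chi n).

Definition cesaro_avg (R : realType) (N : nat) (a : nat -> R[i]) : R[i] :=
  N%:R^-1 * \sum_(1 <= n < N.+1) a n.

Definition log_avg (R : realType) (N : nat) (a : nat -> R[i]) : R[i] :=
  (\sum_(1 <= n < N.+1) n%:R^-1)^-1 * \sum_(1 <= n < N.+1) (a n / n%:R).

(* z^eps for a sign eps, which is encoded by a boolean: false stands for 1,
   and true for -1, where z^{-1} means the conjugate of z. *)
Definition sign_pow (R : realType) (eps : bool) (z : R[i]) : R[i] :=
  if eps then z^* else z.

(* E is one of the averaging operators cesaro_avg, log_avg. *)
Definition chowla_elliott (R : realType)
    (E : nat -> (nat -> R[i]) -> R[i]) (N : nat -> nat) (a : nat -> R[i])
  : Prop :=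
  forall (l : nat) (shift : 'I_l -> nat) (eps : 'I_l -> bool),
    (0 < l)%N -> injective shift ->
    (fun k => E (N k) (fun n => \prod_(i < l) sign_pow (eps i) (a (n + shift i)%N)))
      @ \oo --> (0 : R[i]^o).

(* Main.v *)
Require Import Defs.
From mathcomp Require Import all_boot all_order all_algebra.
From mathcomp Require Import complex ring lra zify cyclic.
From mathcomp Require Import all_classical all_reals all_analysis.
Set Implicit Arguments.
Unset Strict Implicit.
Unset Printing Implicit Defensive.
Import Order.TTheory GRing.Theory Num.Theory numFieldNormedType.Exports.
Local Open Scope ring_scope.
Local Open Scope complex_scope.

(** Two facts are combined: a sequence of signs satisfying the Chowla-Elliott
    conjecture behaves like white noise, and a pretentious multiplicative
    function is almost periodic in mean.

    White noise. Let [A n] be a product of translates [a (n + s)] over a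
    nonempty finite set of shifts. As [a ^ 2 = 1], for [c <> c'] the product
    [A (n + c) * A (n + c')] is again such a product, over the symmetric
    difference of two different translates of the set of shifts
    ([shift_pattern_symdiff]); so the two-point correlations of [A] vanish in
    the limit ([chowla_white_noise]).

    Almost periodicity ([pretentious_almost_periodic]). For every [eps] there
    is a [q] such that for every [m] the mean of [|f (n + q m) - f n|] is
    asymptotically at most [eps]. Write [n = s u] with [s] composed of primes
    up to [y] and [u] of larger primes. If [q] is divisible by a high power of
    every prime up to [y], then [n] and [n + q m] have the same [s], outside a
    sparse set. Next, [f(u) = u^{it} chi(u) g(u)], where the sum of
    [(1 - Re g(p)) / p] over [p > y] is small. The factor [u^{it}] varies
    slowly, and the translation changes [u] by a multiple of the period of
    [chi]. Finally
    [g(p)] differs from [exp (i Im g(p))] by [O (1 - Re g(p))], so that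
    [g(u)] is close in mean to [exp (i Theta(n))], where [Theta] is the
    additive function with values [Im g(p)] at the primes [p > y]. The sum of
    [Im g(p) ^ 2 / p] is small, and a Turan-Kubilius inequality
    ([turan_kubilius]) shows that [Theta] is concentrated near a constant on
    [1 .. N]. The constant depends on [N], but it cancels in the comparison of
    [n] with [n + q m] ([multiplicative_dist]).

    Conclusion ([white_noise_orthogonal]). The product over the shifts of
    [b = a f] is [A F], where [F] is a product of translates of [f] and of its
    conjugate and is therefore almost periodic as well. The mean of [A F] is
    close to the mean over [n] of [F n] times the average of [A (n + q m)] over
    [m < M], and by Cauchy-Schwarz that is [O (1 / sqrt M)] because [A] is
    white noise.

    Cesaro and logarithmic averages are treated together, as averages with
    nonincreasing weights whose sum diverges: such averages are nearly
    translation invariant ([weighted_shift]), and bounds for Cesaro means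
    carry over to them by partial summation ([abel_sum_le]). *)

(** * The real-valued modulus of a complex number *)

Notation cmod := Normc.normc.

Section Modulus.
Variable R : realType.
Implicit Types x y z : R[i].

Lemma normr_cmod z : `|z| = (cmod z)%:C.
Proof. by case: z. Qed.

Lemma cmod_ge0 z : 0 <= cmod z.
Proof. by case: z => a b; exact: sqrtr_ge0. Qed.

Lemma cmodM x y : cmod (x * y) = cmod x * cmod y.
Proof. exact: Normc.normcM. Qed.

Lemma cmodD x y : cmod (x + y) <= cmod x + cmod y.
Proof. exact: le_normcD. Qed.

Lemma cmodN x : cmod (- x) = cmod x.
Proof. exact: normcN. Qed.

Lemma cmod0 : cmod (0 : R[i]) = 0.
Proof. exact: Normc.normc0. Qed.

Lemma cmod1 : cmod (1 : R[i]) = 1.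
Proof. exact: Normc.normc1. Qed.

Lemma cmodB x y : cmod (x - y) <= cmod x + cmod y.
Proof. by rewrite -(cmodN y) cmodD. Qed.

Lemma cmod_distC x y : cmod (x - y) = cmod (y - x).
Proof. by rewrite -cmodN opprB. Qed.

Lemma cmod_real (a : R) : cmod a%:C = `|a|.
Proof. by rewrite /= expr0n addr0 sqrtr_sqr. Qed.

Lemma cmod_conj z : cmod z^* = cmod z.
Proof. by case: z => a b /=; rewrite sqrrN. Qed.

Lemma cmodX x n : cmod (x ^+ n) = cmod x ^+ n.
Proof. by elim: n => [|n IH]; rewrite ?cmod1 // !exprS cmodM IH. Qed.

Lemma cmod_le1 z : (`|z| <= 1) = (cmod z <= 1).
Proof. by rewrite normr_cmod -(lecR (cmod z) 1). Qed.

Lemma cmod_le_ReIm z : cmod z <= `|complex.Re z| + `|complex.Im z|.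
Proof.
case: z => a b /=; rewrite -[X in _ <= X]ger0_norm ?addr_ge0 //.
rewrite -sqrtr_sqr ler_wsqrtr // sqrrD !real_normK ?num_real //.
by have := mulr_ge0 (normr_ge0 a) (normr_ge0 b); lra.
Qed.

Lemma cmod_sqr z : cmod z ^+ 2 = complex.Re z ^+ 2 + complex.Im z ^+ 2.
Proof. by case: z => a b /=; rewrite sqr_sqrtr // addr_ge0 ?sqr_ge0. Qed.

Lemma cmod_sum (I : Type) (r : seq I) (P : pred I) (F : I -> R[i]) :
  cmod (\sum_(i <- r | P i) F i) <= \sum_(i <- r | P i) cmod (F i).
Proof.
elim/big_rec2: _ => [|i y x _ le_xy]; first by rewrite cmod0.
by rewrite (le_trans (cmodD _ _)) // lerD2l.
Qed.

Lemma cmod_prod_le1 (I : Type) (r : seq I) (P : pred I) (F : I -> R[i]) :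
  (forall i, P i -> cmod (F i) <= 1) -> cmod (\prod_(i <- r | P i) F i) <= 1.
Proof.
move=> F1; elim/big_ind: _ => [|x y x1 y1|]; rewrite ?cmod1 //.
by rewrite cmodM mulr_ile1 ?cmod_ge0.
Qed.

Lemma cmod_mul_dist x y x' y' : cmod x <= 1 -> cmod y' <= 1 ->
  cmod (x * y - x' * y') <= cmod (x - x') + cmod (y - y').
Proof.
move=> x1 y1; have -> : x * y - x' * y' = (x - x') * y' + x * (y - y') by ring.
by rewrite (le_trans (cmodD _ _)) // !cmodM lerD //
  ?ler_piMr ?ler_piMl ?cmod_ge0.
Qed.

(** The factors are replaced one at a time; the others have modulus at most 1
    and do not enlarge the change. *)
Lemma cmod_prod_dist (I : eqType) (r : seq I) (F G : I -> R[i]) :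
  (forall i, i \in r -> cmod (F i) <= 1 /\ cmod (G i) <= 1) ->
  cmod (\prod_(i <- r) F i - \prod_(i <- r) G i) <=
    \sum_(i <- r) cmod (F i - G i).
Proof.
elim: r => [|i r IH] FG1; first by rewrite !big_nil subrr cmod0.
rewrite !big_cons.
have [Fi _] := FG1 i (mem_head _ _).
have FG1' j : j \in r -> cmod (F j) <= 1 /\ cmod (G j) <= 1.
  by move=> jr; apply: FG1; rewrite inE jr orbT.
rewrite (le_trans (cmod_mul_dist _ _ Fi _)) ?lerD2l ?IH //.
rewrite big_seq_cond cmod_prod_le1 // => j.
by rewrite andbT => /FG1'[].
Qed.

End Modulus.

(** * The unit circle *)

Section UnitCircle.
Variable R : realType.
Implicit Types (x y u : R) (z : R[i]).


Definition expi (x : R) : R[i] := cos x +i* sin x.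

Lemma expiD x y : expi (x + y) = expi x * expi y.
Proof.
by rewrite /expi cosD sinD; simpc; congr (_ +i* _); rewrite addrC mulrC.
Qed.

Lemma expi0 : expi 0 = 1.
Proof. by rewrite /expi cos0 sin0. Qed.

Lemma cmod_expi x : cmod (expi x) = 1.
Proof. by rewrite /= cos2Dsin2 sqrtr1. Qed.

Lemma expi_sum (I : Type) (r : seq I) (P : pred I) (F : I -> R) :
  expi (\sum_(i <- r | P i) F i) = \prod_(i <- r | P i) expi (F i).
Proof. exact: (big_morph _ expiD expi0). Qed.

Lemma mvt_lipschitz (f df : R -> R) (c x y : R) :
  (forall x, is_derive x 1 f (df x)) ->
  (forall u, `|u| <= `|x| \/ `|u| <= `|y| -> `|df u| <= c) ->
  `|f y - f x| <= c * `|y - x|.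
Proof.
move=> fdf dfc; wlog xy : x y dfc / x <= y.
  move=> wl; have [/wl|/ltW/wl] := leP x y; first exact.
  by rewrite distrC (distrC y); apply => z [] ?; apply: dfc; [right|left].
have [|z zxy ->] := MVT_segment xy (fun u _ => fdf u).
  apply: continuous_subspaceT => z; apply: differentiable_continuous.
  by apply/derivable1_diffP; case: (fdf z).
rewrite normrM ler_wpM2r // dfc //.
move: zxy; rewrite in_itv /= => /andP[xz zy].
have [z0|z0] := leP 0 z; [right|left].
  by rewrite !ger0_norm // (le_trans z0).
by rewrite !ltr0_norm ?lerN2 // (le_lt_trans xz).
Qed.

Lemma sin_lipschitz x y : `|sin y - sin x : R| <= `|y - x|.
Proof.
rewrite -[leRHS]mul1r; apply: mvt_lipschitz => z ?.
by rewrite ler_norml cos_le1 cos_geN1.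
Qed.

Lemma cos_lipschitz x y : `|cos y - cos x : R| <= `|y - x|.
Proof.
rewrite -[leRHS]mul1r; apply: mvt_lipschitz => z ?.
by rewrite normrN ler_norml sin_le1 sin_geN1.
Qed.

Lemma cmod_expi_dist x y : cmod (expi y - expi x) <= 2 * `|y - x|.
Proof.
rewrite (le_trans (cmod_le_ReIm _)) //= mulr_natl mulr2n lerD //.
- exact: cos_lipschitz.
- exact: sin_lipschitz.
Qed.

Lemma cos_sub1_le x : `|cos x - 1 : R| <= x ^+ 2.
Proof.
rewrite -cos0 -[x ^+ 2]real_normK ?num_real // expr2 -[X in _ * `|X|](subr0 x).
apply: mvt_lipschitz => z zx; rewrite normrN.
have := sin_lipschitz 0 z; rewrite sin0 !subr0 => /le_trans; apply.
by case: zx => //; rewrite normr0 => /le_trans; apply.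
Qed.

Lemma sin_subx_le x : `|x| <= 1 -> `|sin x - x : R| <= x ^+ 2.
Proof.
move=> x1; pose h (u : R) : R := sin u - u.
have hd u : is_derive u 1 h (cos u - 1).
  by apply: is_deriveB.
have -> : sin x - x = h x - h 0 by rewrite /h sin0; ring.
rewrite -[x ^+ 2]real_normK ?num_real // expr2 -[X in _ * `|X|](subr0 x).
apply: (mvt_lipschitz hd) => z zx.
have {}zx : `|z| <= `|x| by case: zx => //; rewrite normr0 => /le_trans; apply.
rewrite (le_trans (cos_sub1_le _)) // -real_normK ?num_real //.
have := normr_ge0 z; nra.
Qed.

(** The imaginary part is controlled only by the square root of [1 - Re z].
    This is why sums of [Im g(p)] over primes need a second moment argument,
    whereas first moments suffice for quantities of size [1 - Re g(p)]. *)
Lemma sqr_Im_le z : cmod z <= 1 ->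
  complex.Im z ^+ 2 <= 2 * (1 - complex.Re z).
Proof.
move=> z1; have : cmod z ^+ 2 <= 1 by rewrite expr_le1 ?cmod_ge0.
rewrite cmod_sqr; nra.
Qed.

Lemma Im_le1 z : cmod z <= 1 -> `|complex.Im z| <= 1.
Proof.
move=> z1; have : cmod z ^+ 2 <= 1 by rewrite expr_le1 ?cmod_ge0.
rewrite cmod_sqr => h; rewrite -(@expr_le1 _ 2) // real_normK ?num_real //.
by apply: le_trans h; rewrite lerDr sqr_ge0.
Qed.

Lemma Re_le1 z : cmod z <= 1 -> complex.Re z <= 1.
Proof.
move=> z1; have : cmod z ^+ 2 <= 1 by rewrite expr_le1 ?cmod_ge0.
rewrite cmod_sqr; nra.
Qed.

(** Passing from [z] to the point of the circle with angle [Im z] is an error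
    of the first-moment kind: [z] and [exp (i Im z)] agree to first order in
    [Im z], and [Im z ^ 2] is [O (1 - Re z)]. *)
Lemma cmod_sub_expi_Im z : cmod z <= 1 ->
  cmod (z - expi (complex.Im z)) <= 5 * (1 - complex.Re z).
Proof.
move=> z1; have b1 := Im_le1 z1; have a1 := Re_le1 z1.
have b2 := sqr_Im_le z1.
rewrite (le_trans (cmod_le_ReIm _)) //.
case: z z1 b1 a1 b2 => a b /= _ b1 a1 b2.
have c := cos_sub1_le b; have s := sin_subx_le b1.
rewrite (distrC b).
have : `|a - cos b| <= `|a - 1| + `|1 - cos b|.
  by rewrite (le_trans _ (ler_normD _ _)) // addrA subrK.
rewrite (distrC 1) (distrC a 1) [`|1 - a|]ger0_norm ?subr_ge0 // => h.
by move: (sin b - b) (cos b - 1) (a - cos b) c s h => u v w; lra.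
Qed.

End UnitCircle.

(** * Weighted sums *)

Section WeightedSums.
Variable R : realType.

Definition nonincr_weight (w : nat -> R) :=
  (forall n, (0 < n)%N -> 0 <= w n) /\
  (forall n, (0 < n)%N -> w n.+1 <= w n).

(** Abel summation, comparing the partial sums of [x] with those of the
    constant sequence [eps]. This carries bounds for Cesaro means over to
    logarithmic ones. *)
Lemma abel_sum_le (w x : nat -> R) (eps C : R) :
  nonincr_weight w ->
  (forall N, \sum_(1 <= n < N.+1) x n <= eps * N%:R + C) ->
  forall N, \sum_(1 <= n < N.+1) w n * x n <=
    eps * \sum_(1 <= n < N.+1) w n + C * w 1%N.
Proof.
move=> [w0 wS] xC [|N].
  by have := xC 0%N; rewrite !big_geq // mulr0 !add0r => C0; rewrite mulr_ge0 ?w0.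
(* The boundary term of the summation by parts makes the induction work. *)
suff : \sum_(1 <= n < N.+2) w n * x n +
    w N.+1 * (eps * N.+1%:R + C - \sum_(1 <= n < N.+2) x n) <=
    eps * \sum_(1 <= n < N.+2) w n + C * w 1%N.
  apply: le_trans; rewrite lerDl mulr_ge0 ?w0 // subr_ge0; exact: xC.
elim: N => [|N IH]; first by rewrite !big_nat1 le_eqVlt; apply/orP; left; apply/eqP; ring.
rewrite [\sum_(1 <= n < N.+3) (w n * x n)]big_nat_recr //=.
rewrite [\sum_(1 <= n < N.+3) x n]big_nat_recr //=.
rewrite [\sum_(1 <= n < N.+3) w n]big_nat_recr //=.
have := xC N.+1; have := wS N.+1 isT.
move: IH; rewrite (natrD _ 1 N.+1).
move: (\sum_(1 <= n < N.+2) _) (\sum_(1 <= n < N.+2) _)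
  (\sum_(1 <= n < N.+2) _) => A B D IH wle DC.
have := mulr_ge0 (_ : 0 <= w N.+1 - w N.+2) (_ : 0 <= eps * N.+1%:R + C - B).
rewrite !subr_ge0 => /(_ wle DC); move: IH; lra.
Qed.

(** After summation by parts the coefficient of [x n] is [w n.-1 - w n], and
    these nonnegative coefficients telescope. *)
Lemma weighted_shift1 (w : nat -> R) (x : nat -> R[i]) (B : R) N :
  nonincr_weight w -> (forall n, (0 < n)%N -> cmod (x n) <= B) ->
  cmod (\sum_(1 <= n < N.+1) (w n)%:C * (x n.+1 - x n)) <= 2 * B * w 1%N.
Proof.
move=> [w0 wS] xB.
have B0 : 0 <= B by apply: le_trans (xB 1%N isT); exact: cmod_ge0.
case: N => [|N]; first by rewrite big_geq // cmod0 !mulr_ge0 ?w0.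
suff : cmod (\sum_(1 <= n < N.+2) (w n)%:C * (x n.+1 - x n) -
    (w N.+1)%:C * x N.+2) <= B * (2 * w 1%N - w N.+1).
  have : cmod ((w N.+1)%:C * x N.+2) <= w N.+1 * B.
    by rewrite cmodM cmod_real ger0_norm ?w0 // ler_wpM2l ?w0 ?xB.
  move: (\sum_(1 <= n < N.+2) _) (_ * x N.+2) => A D DB AD.
  have : cmod A <= cmod (A - D) + cmod D by rewrite -{1}(subrK D A) cmodD.
  lra.
elim: N => [|N IH].
  rewrite big_nat1; have -> : (w 1%N)%:C * (x 2 - x 1%N) - (w 1%N)%:C * x 2 =
    - ((w 1%N)%:C * x 1%N) by ring.
  rewrite cmodN cmodM cmod_real ger0_norm ?w0 //.
  by rewrite (le_trans (ler_wpM2l _ (xB 1%N isT))) ?w0 // mulrC; lra.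
rewrite big_nat_recr //=.
move: IH; move: (\sum_(1 <= n < N.+2) _) => A IH.
have -> : A + (w N.+2)%:C * (x N.+3 - x N.+2) - (w N.+2)%:C * x N.+3 =
   (A - (w N.+1)%:C * x N.+2) + (w N.+1 - w N.+2)%:C * x N.+2.
  by rewrite rmorphB /=; ring.
rewrite (le_trans (cmodD _ _)) // cmodM cmod_real.
rewrite ger0_norm ?subr_ge0 ?wS //.
have := ler_wpM2l (_ : 0 <= w N.+1 - w N.+2) (xB N.+2 isT).
rewrite subr_ge0 => /(_ (wS N.+1 isT)); move: IH; lra.
Qed.

Lemma weighted_shift (w : nat -> R) (x : nat -> R[i]) (B : R) N d :
  nonincr_weight w -> (forall n, (0 < n)%N -> cmod (x n) <= B) ->
  cmod (\sum_(1 <= n < N.+1) (w n)%:C * x (n + d)%N -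
        \sum_(1 <= n < N.+1) (w n)%:C * x n) <= 2 * B * w 1%N * d%:R.
Proof.
move=> wP xB; elim: d => [|d IH].
  under eq_bigr do rewrite addn0.
  by rewrite subrr cmod0 mulr0.
have xB' n : (0 < n)%N -> cmod (x (n + d)%N) <= B.
  by move=> n0; apply: xB; rewrite addn_gt0 n0.
have := weighted_shift1 N wP xB'.
under eq_bigr do rewrite mulrBr.
rewrite sumrB => h; rewrite -[d.+1%:R]natr1 mulrDr mulr1 [leRHS]addrC.
set S1 := \sum_(1 <= n < N.+1) _ * x (n + d.+1)%N.
have -> : S1 = \sum_(1 <= i < N.+1) (w i)%:C * x (i.+1 + d)%N.
  by apply: eq_bigr => i _; rewrite addSnnS.
set S0 := \sum_(1 <= n < N.+1) (w n)%:C * x n.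
move: h IH; rewrite -/S0; set S2 := \sum_(1 <= n < N.+1) _ * x (n + d)%N.
set S3 := \sum_(1 <= n < N.+1) _ => h IH.
have -> : S3 - S0 = (S3 - S2) + (S2 - S0) by ring.
by rewrite (le_trans (cmodD _ _)) // lerD.
Qed.

Lemma weighted_shift_real (w x : nat -> R) (B : R) N d :
  nonincr_weight w -> (forall n, (0 < n)%N -> `|x n| <= B) ->
  \sum_(1 <= n < N.+1) w n * x (n + d)%N <=
    \sum_(1 <= n < N.+1) w n * x n + 2 * B * w 1%N * d%:R.
Proof.
move=> wP xB; have := @weighted_shift w (fun n => (x n)%:C) B N d wP.
under eq_bigr do rewrite -rmorphM.
under [X in _ - X]eq_bigr do rewrite -rmorphM.
rewrite -!rmorph_sum -rmorphB cmod_real => h.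
rewrite -lerBlDl; apply: le_trans (ler_norm _) _.
by apply: h => n n0; rewrite cmod_real xB.
Qed.

Lemma eventually_small_sum (x : nat -> R) (eps : R) n0 N :
  0 <= eps -> (forall n, 0 <= x n) -> (forall n, (n0 < n)%N -> x n <= eps) ->
  \sum_(1 <= n < N.+1) x n <= eps * N%:R + \sum_(1 <= n < n0.+1) x n.
Proof.
move=> eps0 x0 xeps; elim: N => [|N IH].
  by rewrite big_geq // mulr0 add0r sumr_ge0.
have [Nn0|n0N] := leqP N.+1 n0.
  rewrite (@big_cat_nat _ _ _ N.+2 1 n0.+1) //= addrCA lerDl.
  by rewrite addr_ge0 ?mulr_ge0 // sumr_ge0.
rewrite big_nat_recr //= -natr1 mulrDr mulr1 addrAC lerD //.
exact: xeps.
Qed.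

End WeightedSums.

(** * Counting multiples *)

Section Counting.
Variable R : realType.

Lemma sum_dvdn d N : (0 < d)%N ->
  \sum_(1 <= n < N.+1) (d %| n)%:R = (N %/ d)%:R :> R.
Proof.
move=> d0; elim: N => [|N IH]; first by rewrite big_geq // div0n.
by rewrite big_nat_recr //= IH divnS // natrD addrC.
Qed.

Lemma divn_le_natr N d : (0 < d)%N -> (N %/ d)%:R <= N%:R / d%:R :> R.
Proof. by move=> d0; rewrite ler_pdivlMr ?ltr0n // -natrM ler_nat leq_trunc_div. Qed.

Lemma divn_ge_natr N d : (0 < d)%N -> N%:R / d%:R - 1 <= (N %/ d)%:R :> R.
Proof.
move=> d0; rewrite lerBlDr natr1 ler_pdivrMr ?ltr0n // -natrM ler_nat.
by rewrite ltnW // ltn_ceil.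
Qed.

Lemma sum_dvdn_le d N : (0 < d)%N ->
  \sum_(1 <= n < N.+1) (d %| n)%:R <= N%:R / d%:R :> R.
Proof. by move=> d0; rewrite sum_dvdn // divn_le_natr. Qed.

Lemma big_primes_gt (V : nmodType) (F : nat -> V) y n N : (0 < n <= N)%N ->
  \sum_(p <- primes n | (y < p)%N) F p =
  \sum_(y.+1 <= p < N.+1 | prime p && (p %| n)%N) F p.
Proof.
move=> /andP[n0 nN]; rewrite -big_filter -[RHS]big_filter.
apply: perm_big; apply: uniq_perm; rewrite ?filter_uniq ?primes_uniq ?iota_uniq //.
move=> p; rewrite !mem_filter mem_index_iota mem_primes n0 /=.
rewrite ltnS; apply/andP/andP => [[yp /andP[-> pn]]|[/andP[-> pn] /andP[-> _]]] //.
by rewrite pn yp (leq_trans (dvdn_leq _ pn)).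
Qed.

Lemma sum_primes_gt (F : nat -> R) y n N : (0 < n <= N)%N ->
  \sum_(p <- primes n | (y < p)%N) F p =
  \sum_(y.+1 <= p < N.+1 | prime p) F p * (p %| n)%:R.
Proof.
move=> nN; rewrite (big_primes_gt _ _ nN) big_mkcondr; apply: eq_bigr => p _.
by case: ifP; rewrite ?mulr1 ?mulr0.
Qed.

Lemma sum_sum_primes_le (F : nat -> R) y N (rho : R) :
  (forall p, prime p -> (y < p)%N -> 0 <= F p) ->
  \sum_(y.+1 <= p < N.+1 | prime p) F p / p%:R <= rho ->
  \sum_(1 <= n < N.+1) \sum_(p <- primes n | (y < p)%N) F p <= rho * N%:R.
Proof.
move=> F0 Frho; rewrite (eq_big_nat _ _ (F2 := fun n =>
  \sum_(y.+1 <= p < N.+1 | prime p) F p * (p %| n)%:R)); last first.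
  by move=> n nN; apply: sum_primes_gt.
rewrite exchange_big /= (le_trans _ (ler_wpM2r (ler0n _ N) Frho)) // mulr_suml.
rewrite big_nat_cond [leRHS]big_nat_cond; apply: ler_sum => p.
move=> /andP[/andP[yp _] pp].
rewrite -mulr_sumr -mulrA ler_wpM2l ?F0 // mulrC sum_dvdn_le ?prime_gt0 //.
Qed.

Lemma inv_sqr_le (u : R) : 0 < u -> ((u + 1) ^+ 2)^-1 <= u^-1 - (u + 1)^-1.
Proof.
move=> u0; have u1 : 0 < u + 1 by lra.
rewrite -subr_ge0; have -> : u^-1 - (u + 1)^-1 - ((u + 1) ^+ 2)^-1 =
    (u * (u + 1) ^+ 2)^-1 by field; rewrite !gt_eqF.
by rewrite invr_ge0 mulr_ge0 ?sqr_ge0 // ltW.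
Qed.

Lemma sum_inv_sqr_le y N : (0 < y)%N ->
  \sum_(y.+1 <= p < N.+1) (p%:R ^+ 2)^-1 <= y%:R^-1 :> R.
Proof.
move=> y0; have [Ny|yN] := leqP N y; first by rewrite big_geq ?invr_ge0.
suff : \sum_(y.+1 <= p < N.+1) (p%:R ^+ 2)^-1 <= y%:R^-1 - N%:R^-1 :> R.
  by move=> /le_trans; apply; rewrite gerBl invr_ge0.
elim: N yN => [//|N IH]; rewrite ltnS leq_eqVlt => /predU1P[<-|yN].
  by rewrite big_nat1 -natr1 inv_sqr_le ?ltr0n.
rewrite big_nat_recr //=; last by rewrite ltnS ltnW.
apply: le_trans (lerD (IH yN) (lexx _)) _.
have NR : 0 < N%:R :> R by rewrite ltr0n (leq_trans _ yN).
by rewrite -natr1; have := inv_sqr_le NR; lra.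
Qed.

End Counting.

(** * Concentration of additive functions *)

Section TuranKubilius.
Variable R : realType.
Implicit Types (theta : nat -> R).

(** The density [1 / (p p')] of the multiples of both primes is the product of
    the two densities; what is left for [p <> p'] are rounding errors. *)
Lemma prime_correlation_le p p' N : prime p -> prime p' ->
  `|\sum_(1 <= n < N.+1) ((p %| n)%:R - p%:R^-1) * ((p' %| n)%:R - p'%:R^-1)|
  <= (p == p')%:R * (N%:R / p%:R) + 2 :> R.
Proof.
move=> pp pp'; have p0 := prime_gt0 pp; have p'0 := prime_gt0 pp'.
have gp : (2 : R) <= p%:R by rewrite ler_nat prime_gt1.
have gp' : (2 : R) <= p'%:R by rewrite ler_nat prime_gt1.
have -> : \sum_(1 <= n < N.+1)
    ((p %| n)%:R - p%:R^-1) * ((p' %| n)%:R - p'%:R^-1) =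
    \sum_(1 <= n < N.+1) (p %| n)%:R * (p' %| n)%:R
    - p'%:R^-1 * \sum_(1 <= n < N.+1) (p %| n)%:R
    - p%:R^-1 * \sum_(1 <= n < N.+1) (p' %| n)%:R + N%:R * (p%:R^-1 / p'%:R) :> R.
  have -> : N%:R * (p%:R^-1 / p'%:R) =
      \sum_(1 <= n < N.+1) (p%:R^-1 / p'%:R) :> R.
    by rewrite sumr_const_nat subn1 mulr_natl.
  rewrite !mulr_sumr -!sumrB -big_split /=.
  by apply: eq_bigr => n _; ring.
rewrite !sum_dvdn //.
have [a1 a2] := (divn_le_natr R N p0, divn_ge_natr R N p0).
have [b1 b2] := (divn_le_natr R N p'0, divn_ge_natr R N p'0).
have i1 : 0 < (p%:R^-1 : R) by rewrite invr_gt0; lra.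
have i2 : (p%:R^-1 : R) <= 2^-1 by rewrite lef_pV2 ?posrE //; lra.
have i1' : 0 < (p'%:R^-1 : R) by rewrite invr_gt0; lra.
have i2' : (p'%:R^-1 : R) <= 2^-1 by rewrite lef_pV2 ?posrE //; lra.
have N0 : 0 <= N%:R :> R by [].
have [<-|npp'] := eqVneq p p'.
  rewrite mul1r; under eq_bigr do rewrite -natrM mulnb andbb.
  rewrite sum_dvdn //.
  move: a1 a2 i1 i2; move: (N %/ p)%:R (p%:R^-1) => e u a1 a2 i1 i2.
  have : 0 <= N%:R * u by rewrite mulr_ge0 // ltW.
  rewrite ler_norml => ?; apply/andP; split; nra.
have cop : coprime p p' by rewrite prime_coprime // dvdn_prime2.
rewrite mul0r add0r; under eq_bigr do rewrite -natrM mulnb -Gauss_dvd //.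
rewrite sum_dvdn ?muln_gt0 ?p0 //.
have := divn_le_natr R N (_ : 0 < p * p')%N; have := divn_ge_natr R N (_ : 0 < p * p')%N.
rewrite muln_gt0 p0 p'0 => /(_ isT) + /(_ isT).
rewrite natrM invfM.
move: a1 a2 b1 b2 i1 i2 i1' i2'.
move: (N %/ p)%:R (N %/ p')%:R (N %/ (p * p'))%:R (p%:R^-1) (p'%:R^-1).
move=> e e' e'' u u' a1 a2 b1 b2 i1 i2 i1' i2' c1 c2.
have h1 := ler_wpM2l (ltW i1') a1; have h2 := ler_wpM2l (ltW i1') a2.
have h3 := ler_wpM2l (ltW i1) b1; have h4 := ler_wpM2l (ltW i1) b2.
rewrite ler_norml; apply/andP; split; nra.
Qed.

(** Expanding the square leaves the diagonal and at most [z ^ 2] rounding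
    errors. *)
Lemma small_primes_variance theta (s : seq nat) (z : nat) N :
  (forall p, `|theta p| <= 1) -> uniq s -> all prime s -> (size s <= z)%N ->
  \sum_(1 <= n < N.+1)
     (\sum_(p <- s) theta p * ((p %| n)%:R - p%:R^-1)) ^+ 2 <=
  N%:R * (\sum_(p <- s) theta p ^+ 2 / p%:R) + 2 * z%:R ^+ 2.
Proof.
move=> th1 us /allP ps sz.
under eq_bigr do rewrite expr2 mulr_suml.
rewrite exchange_big /=.
under eq_bigr => p _.
  under eq_bigr do rewrite mulr_sumr.
  rewrite exchange_big /=.
  over.
apply: (@le_trans _ _ (\sum_(p <- s) \sum_(p' <- s)
  ((p == p')%:R * (N%:R * (theta p ^+ 2 / p%:R)) + 2))).
  rewrite big_seq [leRHS]big_seq; apply: ler_sum => p /ps pp.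
  rewrite big_seq [leRHS]big_seq; apply: ler_sum => p' /ps pp'.
  apply: (@le_trans _ _ (theta p * theta p' * \sum_(1 <= n < N.+1)
    ((p %| n)%:R - p%:R^-1) * ((p' %| n)%:R - p'%:R^-1))).
    by rewrite mulr_sumr le_eqVlt; apply/orP; left; apply/eqP; apply: eq_bigr => n _; ring.
  have := prime_correlation_le N pp pp'; move: (\sum_(_ <= _ < _) _) => K.
  have [<-|_] := eqVneq p p'.
    rewrite !mul1r ler_norml => /andP[_ K2]; have := sqr_ge0 (theta p).
    have : theta p ^+ 2 <= 1 by rewrite -real_normK ?num_real // expr_le1.
    have -> : N%:R * (theta p ^+ 2 / p%:R) = theta p ^+ 2 * (N%:R / p%:R).
      by rewrite mulrCA.
    move: (theta p) (N%:R / p%:R : R) K2 => t c.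
    rewrite -expr2 => K2 t1 t0; have := ler_wpM2l t0 K2.
    by move=> /le_trans; apply; rewrite mulrDr lerD2l; lra.
  rewrite !mul0r !add0r => K2; apply: le_trans (ler_norm _) _.
  rewrite !normrM -[leRHS]mul1r ler_pM // ?mulr_ge0 //.
  by rewrite mulr_ile1.
rewrite mulr_sumr.
rewrite [leLHS](_ : _ = \sum_(p <- s) (N%:R * (theta p ^+ 2 / p%:R) +
    2 * (size s)%:R)); last first.
  apply: eq_big_seq => p ps'; rewrite big_split /= (bigD1_seq p) //= eqxx mul1r.
  rewrite big1 ?addr0 => [|p']; last by rewrite eq_sym => /negPf ->; rewrite mul0r.
  by rewrite big_const_seq count_predT iter_addr_0 mulr_natr.
rewrite big_split /= lerD2l big_const_seq count_predT iter_addr_0.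
rewrite -[_ *+ size s]mulr_natr -mulrA -expr2 ler_pM2l // ler_pXn2r ?nnegrE //.
by rewrite ler_nat.
Qed.

(** An [n < z.+1 ^ 3] has at most two prime factors beyond [z]. *)
Lemma large_primes_le theta (z n N : nat) (lam : R) :
  0 < lam -> (0 < n <= N)%N -> (N < z.+1 ^ 3)%N ->
  `|\sum_(p <- primes n | (z < p)%N) theta p| <=
     \sum_(p <- primes n | (z < p)%N) (theta p ^+ 2 / (2 * lam)) + lam.
Proof.
move=> lam0 /andP[n0 nN] Nz.
have cnt : (count (fun p => z < p)%N (primes n) <= 2)%N.
  (* The product of the primes beyond [z] that divide [n] is at most [n]. *)
  rewrite -ltnS -(@ltn_exp2l z.+1) //; last first.
    by case: (z) Nz => // N1; move: n0; rewrite lt0n -leqn0 (leq_trans nN).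
  apply: leq_ltn_trans Nz; apply: leq_trans nN.
  apply: (@leq_trans (\prod_(p <- primes n) p)%N).
    elim: (primes n) (all_prime_primes n) => [|p s IH] /=; first by rewrite big_nil.
    move=> /andP[pp /IH {}IH]; rewrite big_cons expnD.
    by rewrite leq_mul //; case: ltnP => zp; rewrite ?expn1 // expn0 prime_gt0.
  rewrite [leqRHS](prod_prime_decomp n0) /primes /unzip1 big_map.
  rewrite big_seq [leqRHS]big_seq; apply: leq_prod => -[p e] /mem_prime_decomp[pp e0 _].
  by rewrite -{1}(expn1 p) leq_pexp2l // prime_gt0.
apply: le_trans (ler_norm_sum _ _ _) _.
apply: (@le_trans _ _ (\sum_(p <- primes n | (z < p)%N)
   (theta p ^+ 2 / (2 * lam) + lam / 2))).
  apply: ler_sum => p _; rewrite -[theta p ^+ 2]real_normK ?num_real //.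
  move: (`|theta p|) => t; rewrite -subr_ge0.
  have -> : t ^+ 2 / (2 * lam) + lam / 2 - t = (t - lam) ^+ 2 / (2 * lam).
    by field; rewrite gt_eqF.
  by rewrite divr_ge0 ?sqr_ge0 //; lra.
rewrite big_split /= lerD2l big_const_seq iter_addr_0.
rewrite -[_ *+ count _ _]mulr_natl.
have : (count (fun p => z < p)%N (primes n))%:R <= (2 : R) by rewrite ler_nat.
move: (count _ _)%:R => c; nra.
Qed.


Lemma icbrt_ex N : exists z, (z ^ 3 <= N < z.+1 ^ 3)%N.
Proof.
elim: N => [|N [z /andP[zN Nz]]]; first by exists 0%N.
have [h|h] := ltnP N.+1 (z.+1 ^ 3)%N.
  by exists z; rewrite h (leq_trans zN).
exists z.+1; rewrite h (leq_ltn_trans Nz) // ltn_exp2r //.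
Qed.

Lemma sum_primes_le theta z n : (0 < n)%N ->
  \sum_(p <- primes n | ~~ (z < p)%N) theta p =
  \sum_(p <- [seq p <- index_iota 1 z.+1 | prime p]) theta p * (p %| n)%:R.
Proof.
move=> n0; rewrite [RHS](eq_bigr (fun p => if (p %| n)%N then theta p else 0)).
  rewrite -big_mkcond -[LHS]big_filter -[RHS]big_filter.
  apply: perm_big; apply: uniq_perm; rewrite ?filter_uniq ?primes_uniq ?iota_uniq //.
  move=> p; rewrite !mem_filter mem_index_iota mem_primes n0 /= -leqNgt ltnS.
  by case: (prime p) (@prime_gt0 p); rewrite ?andbF // => ->; case: dvdn; case: leq.
by move=> p _; case: ifP; rewrite ?mulr1 ?mulr0.
Qed.

(** A form of the Turan-Kubilius inequality. Up to the cube root [z] of [N]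
    the second moment is computed; of the primes beyond [z] an [n <= N] has at
    most two, so that there the arithmetic-geometric inequality reduces
    [theta] to [theta ^ 2], whose mean is small. *)
Lemma turan_kubilius theta (lam : R) N :
  (forall p, `|theta p| <= 1) -> 0 < lam ->
  (forall N, \sum_(1 <= p < N.+1 | prime p) theta p ^+ 2 / p%:R <= lam ^+ 2) ->
  exists mu : R,
    \sum_(1 <= n < N.+1) `|\sum_(p <- primes n) theta p - mu| <=
    4 * lam * N%:R + lam ^- 5.
Proof.
move=> th1 lam0 thlam; have [z /andP[zN Nz]] := icbrt_ex N.
pose s := [seq p <- index_iota 1 z.+1 | prime p].
exists (\sum_(p <- s) theta p / p%:R).
have us : uniq s by rewrite filter_uniq // iota_uniq.
have ps : all prime s by apply/allP => p; rewrite mem_filter => /andP[].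
have sz : (size s <= z)%N.
  by rewrite size_filter (leq_trans (count_size _ _)) // size_iota subn1.
have var := small_primes_variance N th1 us ps sz.
have thz := thlam z; rewrite -big_filter -/s in thz.
have thN := thlam N.
pose S n := \sum_(p <- s) theta p * ((p %| n)%:R - p%:R^-1) : R.
pose L n := \sum_(p <- primes n) (theta p ^+ 2 / (2 * lam)) : R.
apply: (@le_trans _ _ (\sum_(1 <= n < N.+1)
   ((S n ^+ 2 / (2 * lam) + lam / 2) + (L n + lam)))).
  rewrite big_nat_cond [leRHS]big_nat_cond; apply: ler_sum => n.
  rewrite andbT => /andP[n0 nN].
  rewrite (bigID (fun p => z < p)%N) /= sum_primes_le // -/s -addrA addrC.
  rewrite -sumrB; under [X in X + _]eq_bigr do rewrite -mulrBr.
  rewrite -/(S n); apply: le_trans (ler_normD _ _) _; apply: lerD.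
    rewrite -[S n ^+ 2]real_normK ?num_real //.
    move: (`|S n|) => t; rewrite -subr_ge0.
    have -> : t ^+ 2 / (2 * lam) + lam / 2 - t = (t - lam) ^+ 2 / (2 * lam).
      by field; rewrite gt_eqF.
    by rewrite divr_ge0 ?sqr_ge0 //; lra.
  apply: le_trans (large_primes_le _ lam0 _ Nz) _; first by rewrite n0.
  rewrite lerD2r /L [leRHS](bigID (fun p => z < p)%N) /= lerDl sumr_ge0 // => p _.
  by rewrite divr_ge0 ?sqr_ge0 //; lra.
have HS : \sum_(1 <= n < N.+1) S n ^+ 2 <= N%:R * lam ^+ 2 + 2 * z%:R ^+ 2.
  by apply: le_trans var _; rewrite lerD2r ler_wpM2l.
have HL : \sum_(1 <= n < N.+1) L n <= lam / 2 * N%:R.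
  have := @sum_sum_primes_le R (fun p => theta p ^+ 2 / (2 * lam)) 0 N (lam / 2).
  rewrite (_ : \sum_(1 <= n < N.+1) \sum_(p <- primes n | (0 < p)%N) _ =
      \sum_(1 <= n < N.+1) L n); last first.
    apply: eq_bigr => n _; rewrite /L big_seq_cond [RHS]big_seq_cond.
    apply: eq_bigl => p; rewrite andbT; apply: andb_idr.
    by rewrite mem_primes => /andP[/prime_gt0].
  apply; first by move=> p _ _; rewrite divr_ge0 ?sqr_ge0 //; lra.
  have -> : \sum_(1 <= p < N.+1 | prime p) theta p ^+ 2 / (2 * lam) / p%:R =
     \sum_(1 <= p < N.+1 | prime p) theta p ^+ 2 / p%:R * (2 * lam)^-1 :> R.
    by apply: eq_bigr => p _; rewrite mulrAC.
  rewrite -mulr_suml ler_pdivrMr ?mulr_gt0 //.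
  by apply: le_trans thN _; rewrite expr2; lra.
rewrite !big_split /= -mulr_suml !sumr_const_nat subn1 /=.
rewrite -[lam / 2 *+ _]mulr_natr -[lam *+ _]mulr_natr.
(* [z ^ 2] is of smaller order than [N >= z ^ 3]: compare [z] with
   [lam ^ -2]. *)
have Hz : z%:R ^+ 2 <= lam ^+ 2 * N%:R + lam ^- 4.
  have [h|h] := leP (lam ^- 2) z%:R.
    apply: (@le_trans _ _ (lam ^+ 2 * N%:R)); last first.
      by rewrite lerDl invr_ge0 exprn_ge0 // ltW.
    apply: (@le_trans _ _ (lam ^+ 2 * z%:R ^+ 3)); last first.
      by rewrite ler_wpM2l ?sqr_ge0 // -natrX ler_nat.
    rewrite (exprS z%:R 2) mulrA ler_peMl ?sqr_ge0 //.
    by rewrite -(@ler_pdivrMl _ (lam ^+ 2)) ?mulr1 // exprn_gt0.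
  apply: (@le_trans _ _ (lam ^- 4)); last first.
    by rewrite lerDr mulr_ge0 ?sqr_ge0.
  have -> : lam ^- 4 = (lam ^- 2) ^+ 2 by rewrite exprVn -exprM.
  by rewrite ler_pXn2r ?nnegrE // ?ltW // invr_gt0 exprn_gt0.
have HS2 : (\sum_(1 <= n < N.+1) S n ^+ 2) / (2 * lam) <=
    (3 / 2) * lam * N%:R + lam ^- 5.
  rewrite ler_pdivrMr ?mulr_gt0 //.
  apply: le_trans HS _.
  have -> : ((3 / 2) * lam * N%:R + lam ^- 5) * (2 * lam) =
      N%:R * lam ^+ 2 + 2 * (lam ^+ 2 * N%:R + lam ^- 4).
    by field; rewrite gt_eqF.
  by rewrite lerD2l ler_pM2l.
have N0 : 0 <= lam * N%:R by rewrite mulr_ge0 // ltW.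
by move: HS2 HL N0; lra.
Qed.

End TuranKubilius.

(** * Multiplicative functions *)

Section Multiplicative.
Variable R : realType.
Implicit Types (f g chi : nat -> R[i]).

Lemma coprime_prime_powers (s : seq nat) (k : nat -> nat) p :
  prime p -> all prime s -> p \notin s ->
  coprime (p ^ k p) (\prod_(r <- s) r ^ k r).
Proof.
move=> pp; elim: s => [|r s IH] /=; first by rewrite big_nil coprimen1.
rewrite inE negb_or => /andP[pr /IH{}IH] /andP[npr /IH{}IH].
rewrite big_cons coprimeMr IH andbT coprimeXl // coprimeXr //.
by rewrite prime_coprime // dvdn_prime2.
Qed.

Lemma multiplicative_prod_primes f n : multiplicative_fun f -> f 1%N = 1 ->
  (0 < n)%N -> f n = \prod_(p <- primes n) f (p ^ logn p n)%N.
Proof.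
move=> fM f1 n0.
rewrite {1}(prod_prime_decomp n0) prime_decompE big_map /=.
elim: (primes n) (all_prime_primes n) (primes_uniq n) => [|p s IH] /=.
  by rewrite !big_nil.
move=> /andP[pp ps] /andP[np us]; rewrite !big_cons -IH // fM //.
- by rewrite big_seq prodn_cond_gt0 // => r rs; rewrite expn_gt0 prime_gt0 // (allP ps).
- exact: (@coprime_prime_powers s (fun r => logn r n)).
Qed.

Lemma character_1 q chi : dirichlet_character q chi -> chi 1%N = 1.
Proof.
move=> [_ _ chiM chi0]; have c1 : chi 1%N != 0 by rewrite chi0 coprime1n.
by apply: (mulfI c1); rewrite mulr1 -chiM muln1.
Qed.

Lemma character_periodic q chi n k : dirichlet_character q chi ->
  chi (n + q * k)%N = chi n.
Proof.
move=> [_ chiP _ _]; elim: k => [|k IH]; first by rewrite muln0 addn0.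
by rewrite mulnS [(q + _)%N]addnC addnA chiP.
Qed.

(** By Euler's theorem [chi n] is a root of unity. *)
Lemma cmod_character q chi n : dirichlet_character q chi -> coprime n q ->
  cmod (chi n) = 1.
Proof.
move=> chiD nq; have [q0 _ chiM _] := chiD.
have chiX k : chi (n ^ k)%N = chi n ^+ k.
  by elim: k => [|k IH]; rewrite ?(character_1 chiD) // expnS chiM IH exprS.
have modq m : chi m = chi (m %% q)%N.
  by rewrite {1}(divn_eq m q) addnC mulnC (character_periodic _ _ chiD).
have : cmod (chi n) ^+ totient q = 1.
  by rewrite -cmodX -chiX modq Euler_exp_totient // -modq (character_1 chiD) cmod1.
by move/eqP; rewrite pexpr_eq1 ?totient_gt0 ?cmod_ge0 // => /eqP.
Qed.

Lemma nat_pow_itE t n : nat_pow_it t n = expi (t * ln n%:R) :> R[i].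
Proof. by []. Qed.

Lemma nat_pow_itM t m n : (0 < m)%N -> (0 < n)%N ->
  nat_pow_it t (m * n) = nat_pow_it t m * nat_pow_it t n :> R[i].
Proof.
move=> m0 n0; rewrite !nat_pow_itE natrM lnM ?posrE ?ltr0n //.
by rewrite mulrDr expiD.
Qed.

Lemma nat_pow_it_dist (t : R) m n : (0 < m <= n)%N ->
  cmod (nat_pow_it t n - nat_pow_it t m) <= 2 * `|t| * (n%:R / m%:R - 1).
Proof.
move=> /andP[m0 mn]; rewrite !nat_pow_itE (le_trans (cmod_expi_dist _ _)) //.
have mR : 0 < m%:R :> R by rewrite ltr0n.
have nR : 0 < n%:R :> R by rewrite ltr0n (leq_trans m0).
rewrite -mulrBr normrM -mulrA; do 2 rewrite ler_wpM2l //.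
rewrite -ln_div ?posrE // ger0_norm; last first.
  by rewrite ln_ge0 // ler_pdivlMr // mul1r ler_nat.
have -> : n%:R / m%:R = 1 + (n%:R / m%:R - 1) :> R by rewrite addrC subrK.
rewrite [leRHS]addrAC subrr add0r.
by rewrite le_ln1Dx // ltrBrDl subrr divr_gt0.
Qed.

(** * Smooth and rough parts of an integer *)

Definition smooth y : nat_pred := [pred p | p <= y]%N.

Lemma logn_add_dvdn p K n d : prime p -> (0 < n)%N -> (p ^ K %| d)%N ->
  ~~ (p ^ K %| n)%N -> logn p (n + d) = logn p n.
Proof.
move=> pp n0 pd pn.
have nd0 : (0 < n + d)%N by rewrite addn_gt0 n0.
have aux e : (e <= K)%N -> (e <= logn p (n + d))%N = (e <= logn p n)%N.
  move=> eK; rewrite -!pfactor_dvdn // dvdn_addl //.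
  exact: dvdn_trans (dvdn_exp2l _ eK) pd.
have lK : (logn p n < K)%N by rewrite ltnNge -pfactor_dvdn.
have lK' : (logn p (n + d) < K)%N by rewrite ltnNge aux // -ltnNge.
apply/eqP; rewrite eqn_leq; apply/andP; split.
  by rewrite -(aux (logn p (n + d))) // ltnW.
by rewrite aux // ltnW.
Qed.

(** If [p ^ K] divides [d] but not [n], then [n] and [n + d] have the same
    [p]-adic valuation. *)
Lemma smooth_part_add y K n d : (0 < n)%N ->
  (forall p, prime p -> (p <= y)%N -> (p ^ K %| d)%N /\ ~~ (p ^ K %| n)%N) ->
  ((n + d)`_(smooth y) = n`_(smooth y))%N.
Proof.
move=> n0 H; rewrite /= {1}/partn (widen_partn _ (leq_addr d n)).
apply: eq_bigr => p; rewrite inE /= => py.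
have [pp|npp] := boolP (prime p); last first.
  have l0 m : logn p m = 0%N by rewrite lognE (negPf npp).
  by rewrite !l0.
by have [pd pn] := H p pp py; rewrite (logn_add_dvdn pp n0 pd pn).
Qed.

Lemma smooth_part_dvd y K n : (0 < n)%N ->
  (forall p, prime p -> (p <= y)%N -> ~~ (p ^ K %| n)%N) ->
  (n`_(smooth y) %| y`! ^ K)%N.
Proof.
move=> n0 H; apply/dvdn_partP => [|p]; first exact: part_gt0.
rewrite inE /= primes_part mem_filter /= mem_primes => /andP[py /and3P[pp _ pn]].
have [pK] : ~~ (p ^ K %| n)%N by apply: H.
rewrite p_part; apply: (@dvdn_trans (p ^ K)); last first.
  by rewrite dvdn_exp2r // dvdn_fact // prime_gt0.
rewrite dvdn_exp2l // ltnW // ltnNge -pfactor_dvdn ?part_gt0 //.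
by apply: contra pK => /dvdn_trans; apply; exact: dvdn_part.
Qed.

Lemma coprime_rough_part y q n : (0 < q <= y)%N ->
  coprime n`_(smooth y)^' q.
Proof.
move=> /andP[q0 qy]; rewrite coprime_sym coprime_pi' ?part_gt0 //.
apply: sub_in_pnat (part_pnat (smooth y)^' n) => p _.
rewrite !inE /= -ltnNge mem_primes => yp.
apply/negP => /and3P[_ _ /(dvdn_leq q0)].
by rewrite leqNgt (leq_ltn_trans qy).
Qed.

End Multiplicative.

(** * The tail of the pretentious distance *)

Section Tail.
Variable R : realType.
Implicit Types (f g : nat -> R[i]).

Lemma pretends_tail f w (delta : R) : disc_valued f ->
  (forall p, prime p -> cmod (w p) <= 1) -> pretends f w -> 0 < delta ->
  exists y0, forall y, (y0 <= y)%N -> forall N,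
    \sum_(y.+1 <= p < N.+1 | prime p) (1 - complex.Re (f p * (w p)^*)) / p%:R
      <= delta.
Proof.
move=> fd wd fw d0; rewrite /pretends /pretdist2 in fw.
have t0 p : prime p -> (0 <= (p%:R^-1 * (1 - complex.Re (f p * (w p)^*)))%:E)%E.
  move=> pp; rewrite lee_fin mulr_ge0 // subr_ge0 Re_le1 //.
  rewrite cmodM cmod_conj mulr_ile1 ?cmod_ge0 ?wd // -cmod_le1 fd //.
  exact: prime_gt0.
have d0' : (0 < delta%:E)%E by rewrite lte_fin.
have [y0 _ Hy0] := nneseries_tail_cvg fw t0 (open_ereal_lt' d0').
exists y0 => y yy0 N.
have /Hy0 /= h : (y0 <= y.+1)%N by rewrite leqW.
have := nneseries_lim_ge N.+1 (fun n (_ : (y.+1 <= n)%N) => t0 n).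
move=> /le_lt_trans/(_ h) /ltW; rewrite sumEFin lee_fin.
by under eq_bigr do rewrite mulrC.
Qed.

End Tail.

(** * Pretentious functions are almost periodic in mean *)

Section AlmostPeriodicity.
Variable R : realType.
Implicit Types (f g w chi : nat -> R[i]) (t mu : R).

(** The angles are set to zero up to [y], so that the additive function built
    from them sees only the rough part of its argument. *)
Definition rough_angle g y p : R := if (y < p)%N then complex.Im (g p) else 0.

Definition additive_angle g y n : R := \sum_(p <- primes n) rough_angle g y p.

Definition rough_error g y n : R :=
  \sum_(p <- primes n | (y < p)%N)
     (5 * (1 - complex.Re (g p)) + 2 * (p ^ 2 %| n)%:R).

Lemma rough_error_ge0 g y n : (forall m, (0 < m)%N -> cmod (g m) <= 1) ->
  0 <= rough_error g y n.
Proof.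
move=> g1; rewrite /rough_error big_seq_cond sumr_ge0 // => p.
rewrite mem_primes => /andP[/and3P[pp _ _] _].
rewrite addr_ge0 ?mulr_ge0 // subr_ge0 Re_le1 // g1 // prime_gt0 //.
Qed.

(** Compare [g] with [exp (i Theta)] prime by prime. A prime dividing [n]
    exactly once contributes [O (1 - Re g(p))]; the trivial bound 2 is used
    for a prime whose square divides [n], which is rare. *)
Lemma rough_part_angle g y n : multiplicative_fun g -> g 1%N = 1 ->
  (forall m, (0 < m)%N -> cmod (g m) <= 1) -> (0 < n)%N ->
  cmod (g (n`_(smooth y)^')%N - expi (additive_angle g y n)) <= rough_error g y n.
Proof.
move=> gM g1 gd n0; set u := (n`_(smooth y)^')%N.
have pu : primes u = [seq p <- primes n | (y < p)%N].
  by rewrite primes_part; apply: eq_filter => p; rewrite !inE /= ltnNge.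
have -> : expi (additive_angle g y n) = \prod_(p <- primes u) expi (complex.Im (g p)).
  rewrite pu big_filter expi_sum [RHS]big_mkcond; apply: eq_bigr => p _.
  by rewrite /rough_angle; case: ifP; rewrite // expi0.
have un : (u %| n)%N by exact: dvdn_part.
rewrite (multiplicative_prod_primes gM g1) ?part_gt0 //.
rewrite /rough_error -[leRHS]big_filter -pu.
have gX p k : prime p -> cmod (g (p ^ k)%N) <= 1.
  by move=> pp; rewrite gd // expn_gt0 prime_gt0.
apply: le_trans (cmod_prod_dist _) _.
  move=> p; rewrite mem_primes => /and3P[pp _ _].
  by rewrite gX // cmod_expi.
rewrite big_seq [leRHS]big_seq; apply: ler_sum => p.
rewrite mem_primes => /and3P[pp _ pdu].
have : (0 < logn p u)%N by rewrite logn_gt0 mem_primes pp part_gt0.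
have gp := gX p 1%N pp; rewrite expn1 in gp.
case El : (logn p u) => [//|[|k]] _.
  by rewrite expn1 (le_trans (cmod_sub_expi_Im gp)) // lerDl mulr_ge0.
have -> : (p ^ 2 %| n)%N.
  by apply: dvdn_trans un; rewrite pfactor_dvdn ?part_gt0 // El.
rewrite (le_trans (cmodB _ _)) // cmod_expi mulr1.
by have := Re_le1 gp; have := gX p k.+2 pp; lra.
Qed.

Definition untwist f w n : R[i] := f n * (w n)^*.

Lemma mul_conj_cmod (z : R[i]) : cmod z = 1 -> z * z^* = 1.
Proof.
by move=> z1; have := sqr_normc z; rewrite normr_cmod z1 => <-; rewrite expr1n.
Qed.

Definition twist t chi n : R[i] := nat_pow_it t n * chi n.

Lemma twistM t q chi m n : dirichlet_character q chi -> (0 < m)%N -> (0 < n)%N ->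
  twist t chi (m * n) = twist t chi m * twist t chi n.
Proof.
move=> [_ _ chiM _] m0 n0; rewrite /twist nat_pow_itM // chiM; ring.
Qed.

Lemma twist1 t q chi : dirichlet_character q chi -> twist t chi 1 = 1.
Proof.
move=> chiD; rewrite /twist (character_1 chiD) nat_pow_itE ln1 mulr0 expi0.
by rewrite mulr1.
Qed.

Lemma cmod_twist t q chi n : dirichlet_character q chi -> coprime n q ->
  cmod (twist t chi n) = 1.
Proof.
by move=> chiD nq; rewrite cmodM cmod_expi (cmod_character chiD nq) mulr1.
Qed.

Lemma cmod_twist_le1 t q chi n : dirichlet_character q chi ->
  cmod (twist t chi n) <= 1.
Proof.
move=> chiD; have [nq|nq] := boolP (coprime n q).
  by rewrite (cmod_twist _ chiD nq).
have [_ _ _ /(_ n)] := chiD; rewrite (negPf nq) => /negbFE/eqP chi0.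
by rewrite /twist chi0 mulr0 cmod0.
Qed.

(** What depends on [n] alone in the comparison of [f (n + d)] with [f n]; the
    constant [mu] is the concentration point of the additive function. *)
Definition local_error g y mu n : R :=
  rough_error g y n + 2 * `|additive_angle g y n - mu|.

(** This is a pointwise inequality, so that no exceptional set has to be
    carried along: where the smooth parts of [n] and [n + d] may differ, the
    first sum is at least 1 and the bound is trivial. *)
Lemma multiplicative_dist f t q chi y K n d mu :
  disc_valued f -> multiplicative_fun f -> f 1%N = 1 ->
  dirichlet_character q chi -> (q <= y)%N ->
  (0 < n)%N -> (q * y`! ^ K %| d)%N ->
  cmod (f (n + d)%N - f n) <=
    2 * \sum_(1 <= p < y.+1 | prime p) (p ^ K %| n)%:R +
    2 * `|t| * (d%:R / n%:R) + (local_error (untwist f (twist t chi)) y mu n +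
     local_error (untwist f (twist t chi)) y mu (n + d)).
Proof.
move=> fd fM f1 chiD qy n0 qd; pose w := twist t chi.
set g := untwist _ _; pose err := local_error g y mu; rewrite -/(err _) -/(err _).
have nd0 : (0 < n + d)%N by rewrite addn_gt0 n0.
have fc m : (0 < m)%N -> cmod (f m) <= 1 by move=> m0; rewrite -cmod_le1 fd.
have gd m : (0 < m)%N -> cmod (g m) <= 1.
  move=> m0; rewrite cmodM cmod_conj mulr_ile1 ?cmod_ge0 ?fc //.
  exact: cmod_twist_le1 chiD.
have gM : multiplicative_fun g.
  move=> m k m0 k0 mk; rewrite /g /untwist fM // (twistM _ chiD) // rmorphM /=.
  by ring.
have g1 : g 1%N = 1 by rewrite /g /untwist f1 (twist1 _ chiD) mul1r; exact: conjc1.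
have err0 m : 0 <= err m by rewrite addr_ge0 ?rough_error_ge0 ?mulr_ge0.
have td0 : 0 <= 2 * `|t| * (d%:R / n%:R) by rewrite !mulr_ge0 // invr_ge0.
have [/hasP[p pr pn]|/hasPn nopow] :=
  boolP (has (fun p => prime p && (p ^ K %| n)%N) (index_iota 1 y.+1)).
  move: pn => /andP[pp pn].
  have : 1 <= \sum_(1 <= p < y.+1 | prime p) (p ^ K %| n)%:R :> R.
    rewrite -big_filter (bigD1_seq p) ?filter_uniq ?iota_uniq ?mem_filter ?pp //=.
    by rewrite pn lerDl sumr_ge0.
  have := err0 n; have := err0 (n + d)%N.
  have := cmodB (f (n + d)%N) (f n); have := fc _ n0; have := fc _ nd0.
  by move: td0; lra.
have Hn p : prime p -> (p <= y)%N -> ~~ (p ^ K %| n)%N.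
  move=> pp py; have := nopow p; rewrite mem_index_iota ltnS py prime_gt0 //.
  by rewrite pp => /(_ isT).
have [q0 _ _ _] := chiD.
have sE : ((n + d)`_(smooth y) = n`_(smooth y))%N.
  apply: (smooth_part_add (K := K) n0) => p pp py; split; last exact: Hn.
  apply: dvdn_trans qd; rewrite dvdn_mull // dvdn_exp2r // dvdn_fact //.
  by rewrite prime_gt0.
have sd := smooth_part_dvd n0 Hn.
set s := (n`_(smooth y))%N in sE sd.
have s0 : (0 < s)%N by exact: part_gt0.
pose u := (n`_(smooth y)^')%N; pose u' := ((n + d)`_(smooth y)^')%N.
have u0 : (0 < u)%N by exact: part_gt0.
have u'0 : (0 < u')%N by exact: part_gt0.
have nE : n = (s * u)%N by rewrite partnC.
have n'E : (n + d = s * u')%N by rewrite -sE partnC.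
have [e u'E] : exists e, u' = (u + q * e)%N.
  have /dvdnP[e de] : (q * s %| d)%N by apply: dvdn_trans qd; rewrite dvdn_mul.
  exists e; apply/eqP; rewrite -(eqn_pmul2l s0) -n'E nE de; apply/eqP.
  by rewrite mulnDr mulnC [(s * (q * e))%N]mulnCA; lia.
have uu' : (u <= u')%N by rewrite u'E leq_addr.
have wu : cmod (w u) = 1.
  by apply: (cmod_twist t chiD); rewrite coprime_rough_part // q0.
have wu' : cmod (w u') = 1.
  by apply: (cmod_twist t chiD); rewrite coprime_rough_part // q0.
have fE v : cmod (w v) = 1 -> f v = g v * w v.
  by move=> wv; rewrite /g /untwist -mulrA [_^* * _]mulrC (mul_conj_cmod wv) mulr1.
(* [chi] agrees at [u] and [u'], which leaves the variation of [u^{it}], and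
   [u' / u = (n + d) / n]. *)
have w_dist : cmod (w u' - w u) <= 2 * `|t| * (d%:R / n%:R).
  rewrite /w /twist [in chi u']u'E (character_periodic _ _ chiD) -mulrBl.
  have -> : cmod ((nat_pow_it t u' - nat_pow_it t u) * chi u) =
      cmod (nat_pow_it t u' - nat_pow_it t u).
    rewrite cmodM (cmod_character chiD) ?mulr1 //.
    by rewrite coprime_rough_part // q0.
  apply: le_trans (nat_pow_it_dist t _) _; first by rewrite u0.
  rewrite ler_wpM2l ?mulr_ge0 //.
  have -> : d%:R = s%:R * u'%:R - s%:R * u%:R :> R.
    by rewrite -!natrM -n'E -nE natrD addrAC subrr add0r.
  rewrite {1}nE natrM le_eqVlt; apply/orP; left; apply/eqP; field.
  by rewrite !pnatr_eq0 -!lt0n u0 s0.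
have g_dist : cmod (g u' - g u) <= err n + err (n + d)%N.
  have h1 := rough_part_angle y gM g1 gd n0.
  have h2 := rough_part_angle y gM g1 gd nd0.
  have h3 := cmod_expi_dist (additive_angle g y n) (additive_angle g y (n + d)).
  have h4 : `|additive_angle g y (n + d) - additive_angle g y n| <=
     `|additive_angle g y (n + d) - mu| + `|additive_angle g y n - mu|.
    rewrite [X in _ <= _ + X]distrC; apply: le_trans (ler_normD _ _).
    by rewrite addrA subrK.
  rewrite -/u in h1; rewrite -/u' in h2; rewrite /err /local_error.
  set x := expi _ in h1 h3; set x' := expi _ in h2 h3.
  have -> : g u' - g u = (g u' - x') + (x' - x) - (g u - x) by ring.
  have := cmodB ((g u' - x') + (x' - x)) (g u - x).
  have := cmodD (g u' - x') (x' - x).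
  by move: h1 h2 h3 h4; lra.
have -> : f n = f s * f u by rewrite {1}nE fM //; exact: coprime_partC.
have -> : f (n + d)%N = f s * f u' by rewrite n'E fM //; exact: coprime_partC.
rewrite -mulrBr cmodM; apply: le_trans (ler_piMl (cmod_ge0 _) (fc _ s0)) _.
rewrite (fE _ wu) (fE _ wu').
apply: le_trans (cmod_mul_dist _ _ (gd _ u'0) _) _; first by rewrite wu.
rewrite addrC; apply: lerD => //.
apply: le_trans w_dist _; rewrite lerDr mulr_ge0 //.
by rewrite sumr_ge0.
Qed.

End AlmostPeriodicity.

Section MeanAlmostPeriodicity.
Variable R : realType.
Implicit Types (f g chi : nat -> R[i]).

Lemma sum_supported_gt (F : nat -> R) y N : (forall p, (p <= y)%N -> F p = 0) ->
  \sum_(1 <= p < N.+1 | prime p) F p = \sum_(y.+1 <= p < N.+1 | prime p) F p.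
Proof.
move=> F0; have [Ny|yN] := leqP N y.
  rewrite [RHS]big_geq // big_nat_cond big1 // => p /andP[/andP[_ pN] _].
  by rewrite F0 // (leq_trans _ Ny).
rewrite (@big_cat_nat _ _ _ y.+1) //= 1?ltnW //.
rewrite big_nat_cond big1 ?add0r // => p /andP[/andP[_ py] _].
by rewrite F0.
Qed.

Lemma sum_prime_powers_le y K N :
  \sum_(1 <= n < N.+1) \sum_(1 <= p < y.+1 | prime p) (p ^ K %| n)%:R <=
  y%:R / 2 ^+ K * N%:R :> R.
Proof.
rewrite exchange_big /=.
apply: (@le_trans _ _ (\sum_(1 <= p < y.+1) (N%:R / 2 ^+ K))).
  rewrite big_mkcond; apply: ler_sum => p _.
  case: ifP => [pp|_]; last by rewrite divr_ge0 // exprn_ge0.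
  apply: le_trans (sum_dvdn_le R N _) _; first by rewrite expn_gt0 prime_gt0.
  rewrite ler_wpM2l // lef_pV2 ?posrE ?exprn_gt0 ?ltr0n ?expn_gt0 ?prime_gt0 //.
  by rewrite -natrX ler_nat; case: (K) => // k; rewrite leq_exp2r // prime_gt1.
by rewrite sumr_const_nat subn1 /= -[_ *+ y]mulr_natl le_eqVlt; apply/orP; left; apply/eqP; ring.
Qed.

Lemma sum_square_divisors_le y N : (0 < y)%N ->
  \sum_(1 <= n < N.+1) \sum_(p <- primes n | (y < p)%N) (p ^ 2 %| n)%:R <=
  y%:R^-1 * N%:R :> R.
Proof.
move=> y0; apply: (@le_trans _ _ (\sum_(1 <= n < N.+1)
    \sum_(y.+1 <= p < N.+1) (p ^ 2 %| n)%:R)).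
  rewrite big_nat_cond [leRHS]big_nat_cond; apply: ler_sum => n.
  rewrite andbT ltnS => nN; rewrite (sum_primes_gt _ _ nN) big_mkcond.
  apply: ler_sum => p _; case: ifP => // _.
  by rewrite ler_piMr //; case: (p %| n)%N.
rewrite exchange_big /=.
apply: le_trans (ler_wpM2r (ler0n _ N) (sum_inv_sqr_le R N y0)).
rewrite mulr_suml big_nat_cond [leRHS]big_nat_cond.
apply: ler_sum => p /andP[/andP[yp _] _].
apply: le_trans (sum_dvdn_le R N _) _; last by rewrite natrX mulrC.
by rewrite expn_gt0 (leq_trans _ yp).
Qed.

Lemma sum_local_error_le g y (lam : R) N : (0 < y)%N -> 2 / lam <= y%:R ->
  (forall m, (0 < m)%N -> cmod (g m) <= 1) -> 0 < lam <= 1 ->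
  (forall M, \sum_(y.+1 <= p < M.+1 | prime p) (1 - complex.Re (g p)) / p%:R
     <= lam ^+ 2 / 2) ->
  exists mu, \sum_(1 <= n < N.+1) local_error g y mu n <=
    12 * lam * N%:R + 2 * lam ^- 5.
Proof.
move=> y0 ylam gd /andP[lam0 lam1] Hg.
have angle0 p : (p <= y)%N -> rough_angle g y p = 0.
  by rewrite /rough_angle ltnNge => ->.
have angle1 p : `|rough_angle g y p| <= 1.
  rewrite /rough_angle; case: ifP => [yp|_]; last by rewrite normr0.
  by rewrite Im_le1 // gd // (leq_trans _ yp).
have angle_sqr M :
    \sum_(1 <= p < M.+1 | prime p) rough_angle g y p ^+ 2 / p%:R <= lam ^+ 2.
  rewrite (@sum_supported_gt _ y) => [|p py]; last first.
    by rewrite angle0 // expr0n mul0r.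
  apply: (@le_trans _ _ (2 * \sum_(y.+1 <= p < M.+1 | prime p)
      (1 - complex.Re (g p)) / p%:R)); last first.
    by have := Hg M; lra.
  rewrite mulr_sumr big_nat_cond [leRHS]big_nat_cond.
  apply: ler_sum => p /andP[/andP[yp _] pp].
  rewrite mulrA ler_wpM2r ?invr_ge0 // /rough_angle yp sqr_Im_le // gd //.
  exact: prime_gt0.
have [mu Hmu] := turan_kubilius N angle1 lam0 angle_sqr.
exists mu; rewrite /local_error big_split /= -mulr_sumr.
have He : \sum_(1 <= n < N.+1) rough_error g y n <=
    5 * (lam ^+ 2 / 2) * N%:R + 2 * (y%:R^-1 * N%:R).
  rewrite /rough_error; under eq_bigr do rewrite big_split /=.
  rewrite big_split /=; apply: lerD.
    apply: sum_sum_primes_le => [p pp _|].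
      by rewrite mulr_ge0 // subr_ge0 Re_le1 // gd // prime_gt0.
    under eq_bigr do rewrite -mulrA.
    by rewrite -mulr_sumr ler_wpM2l.
  under eq_bigr do rewrite -mulr_sumr.
  by rewrite -mulr_sumr ler_wpM2l // sum_square_divisors_le.
have yV : y%:R^-1 <= lam / 2.
  rewrite -[lam / 2]invrK lef_pV2 ?posrE ?ltr0n ?invr_gt0 ?divr_gt0 //.
  by rewrite invf_div.
have N0 : 0 <= N%:R :> R by [].
have h1 := ler_wpM2r N0 yV.
have h2 : lam ^+ 2 * N%:R <= lam * N%:R.
  by rewrite ler_wpM2r // expr2 ler_piMl // ltW.
have h3 : 0 <= lam * N%:R by rewrite mulr_ge0 // ltW.
rewrite /additive_angle; move: Hmu He h1 h2 h3.
by move: (\sum_(1 <= n < _) _) (\sum_(1 <= n < _) _) => A B; lra.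
Qed.

(** The bound of [multiplicative_dist] is summed over [n <= N]. The modulus
    [q] is fixed before [m], so that afterwards arbitrarily many translates by
    multiples of [q] can be averaged. *)
Theorem pretentious_almost_periodic f (eps : R) :
  disc_valued f -> multiplicative_fun f -> pretentious f -> 0 < eps ->
  exists2 q, (0 < q)%N & forall m, exists C, forall N,
    \sum_(1 <= n < N.+1) cmod (f (n + q * m)%N - f n) <= eps * N%:R + C.
Proof.
move=> fd fM [t [q [chi [[chiD _] fw]]]] eps0.
have [f10|f1n0] := eqVneq (f 1%N) 0.
  have f0 n : (0 < n)%N -> f n = 0.
    by move=> n0; rewrite -[n]muln1 fM ?coprimen1 // f10 mulr0.
  exists 1%N => // m; exists 0 => N; rewrite big_nat_cond big1 => [|n].
    by rewrite addr0 mulr_ge0 // ltW.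
  move=> /andP[/andP[n0 _] _].
  by rewrite !f0 ?addn_gt0 ?n0 // subrr cmod0.
have f1 : f 1%N = 1.
  by apply: (mulfI f1n0); rewrite mulr1 -fM // muln1.
pose g := untwist f (twist t chi).
have gd m : (0 < m)%N -> cmod (g m) <= 1.
  move=> m0; rewrite cmodM cmod_conj mulr_ile1 ?cmod_ge0 -?cmod_le1 ?fd //.
  by rewrite cmod_le1; exact: cmod_twist_le1 chiD.
(* The constant 26 collects [lam] for the multiples of prime powers, [lam] for
   [n^{it}], and [12 lam] for each of the two local errors. *)
pose lam := Num.min 1 (eps / 26).
have lam0 : 0 < lam by rewrite lt_min ltr01 divr_gt0.
have lam1 : lam <= 1 by rewrite ge_min lexx.
have lameps : 26 * lam <= eps.
  by have : lam <= eps / 26 by [rewrite ge_min lexx orbT]; lra.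
have [y0 Hy0] := @pretends_tail R f (twist t chi) (lam ^+ 2 / 2) fd
  (fun p _ => cmod_twist_le1 t p chiD) fw (divr_gt0 (exprn_gt0 2 lam0) (ltr0n _ 2)).
have [q0 _ _ _] := chiD.
pose y := (y0 + q + Num.bound (2 / lam))%N.
have ylam : 2 / lam <= y%:R.
  apply: le_trans (ltW (archi_boundP _)) _; first by rewrite divr_ge0 // ltW.
  by rewrite ler_nat leq_addl.
have qy : (q <= y)%N by rewrite /y; lia.
have ypos : (0 < y)%N by exact: leq_trans qy.
have Hy : forall M, \sum_(y.+1 <= p < M.+1 | prime p)
    (1 - complex.Re (g p)) / p%:R <= lam ^+ 2 / 2.
  by apply: Hy0; rewrite /y; lia.
(* Multiples of [p ^ K] with [p <= y] have density at most [y / 2 ^ K]. *)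
pose K := Num.bound (2 * y%:R / lam).
have HK : 2 * (y%:R / 2 ^+ K) <= lam.
  rewrite mulrA ler_pdivrMr ?exprn_gt0 // -ler_pdivrMl // mulrC.
  apply: le_trans (ltW (archi_boundP _)) _.
    by rewrite divr_ge0 ?mulr_ge0 // ltW.
  by rewrite -natrX ler_nat ltnW // ltn_expl.
exists (q * y`! ^ K)%N; first by rewrite muln_gt0 q0 expn_gt0 fact_gt0.
move=> m; set d := (_ * m)%N.
pose c := 2 * `|t| * d%:R; have c0 : 0 <= c by rewrite !mulr_ge0.
pose n0 := Num.bound (c / lam).
exists (\sum_(1 <= n < n0.+1) 2 * `|t| * (d%:R / n%:R) +
  2 * (12 * lam * d%:R + 2 * lam ^- 5)) => N.
have lam01 : 0 < lam <= 1 by rewrite lam0.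
have [mu Hmu] := sum_local_error_le (N + d) ypos ylam gd lam01 Hy.
have err0 n : 0 <= local_error g y mu n.
  by rewrite addr_ge0 ?rough_error_ge0 ?mulr_ge0.
apply: (@le_trans _ _ (\sum_(1 <= n < N.+1)
   (2 * \sum_(1 <= p < y.+1 | prime p) (p ^ K %| n)%:R +
    2 * `|t| * (d%:R / n%:R) +
    (local_error g y mu n + local_error g y mu (n + d))))).
  rewrite big_nat_cond [leRHS]big_nat_cond.
  apply: ler_sum => n /andP[/andP[npos _] _].
  apply: (@multiplicative_dist R f t q chi y K n d mu fd fM f1 chiD qy npos).
  exact: dvdn_mulr.
rewrite big_split /= [X in X + _]big_split /= [X in _ + X]big_split /=.
rewrite -mulr_sumr.
have T1 : 2 * \sum_(1 <= n < N.+1) \sum_(1 <= p < y.+1 | prime p)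
    (p ^ K %| n)%:R <= lam * N%:R :> R.
  apply: le_trans (ler_wpM2l _ (sum_prime_powers_le y K N)) _ => //.
  by rewrite mulrA ler_wpM2r.
have T2 : \sum_(1 <= n < N.+1) 2 * `|t| * (d%:R / n%:R) <=
    lam * N%:R + \sum_(1 <= n < n0.+1) 2 * `|t| * (d%:R / n%:R).
  apply: eventually_small_sum => [|n|n n0n]; first exact: ltW.
    by rewrite !mulr_ge0 // invr_ge0.
  rewrite mulrA -/c ler_pdivrMr ?ltr0n ?(leq_trans _ n0n) //.
  rewrite -ler_pdivrMl // mulrC.
  apply: le_trans (ltW (archi_boundP _)) _; first by rewrite divr_ge0 // ltW.
  by rewrite ler_nat ltnW.
have T3 : \sum_(1 <= n < N.+1) local_error g y mu n <=
    \sum_(1 <= n < (N + d).+1) local_error g y mu n.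
  rewrite [leRHS](@big_cat_nat _ _ _ N.+1) ?ltnS ?leq_addr //= lerDl.
  by rewrite sumr_ge0.
have T4 : \sum_(1 <= n < N.+1) local_error g y mu (n + d) <=
    \sum_(1 <= n < (N + d).+1) local_error g y mu n.
  rewrite [leRHS](@big_cat_nat _ _ _ (1 + d)) ?leq_addr //=; last first.
    by rewrite add1n ltnS leq_addl.
  rewrite big_addn subSn ?leq_addl // addnK lerDr.
  by rewrite sumr_ge0.
have N0 : 0 <= N%:R :> R by [].
have E := ler_wpM2r N0 lameps.
rewrite natrD in Hmu; move: T1 T2 T3 T4 Hmu E.
move: (\sum_(_ <= _ < _) _) (\sum_(_ <= _ < _) _) (\sum_(_ <= _ < _) _)
  (\sum_(_ <= _ < _) _) (\sum_(_ <= _ < _) _) (\sum_(_ <= _ < _) _) (lam ^- 5).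
by move=> A1 A2 A3 A4 A5 A6 l5; lra.
Qed.

End MeanAlmostPeriodicity.

(** * White noise is orthogonal to almost periodic sequences *)

Section Orthogonality.
Variable R : realType.
Implicit Types (w alpha : nat -> R) (F : nat -> R[i]).

Definition total_weight w N : R := \sum_(1 <= n < N.+1) w n.

Definition mean_almost_periodic w F :=
  forall eps : R, 0 < eps -> exists2 q, (0 < q)%N & forall m, exists C, forall N,
    \sum_(1 <= n < N.+1) w n * cmod (F (n + q * m)%N - F n) <=
      eps * total_weight w N + C.

Definition white_noise w (Ns : nat -> nat) alpha :=
  forall c c' : nat, c != c' -> forall eps : R, 0 < eps ->
  exists k0, forall k, (k0 <= k)%N ->
    `|\sum_(1 <= n < (Ns k).+1) w n * (alpha (n + c)%N * alpha (n + c')%N)| <=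
      eps * total_weight w (Ns k).

Definition weight_diverges w (Ns : nat -> nat) :=
  forall A : R, exists k0, forall k, (k0 <= k)%N -> A <= total_weight w (Ns k).

(** Expanding the square, only the [M] diagonal terms survive in the limit;
    the other terms are each at most [1 / M] of the total weight. *)
Lemma white_noise_sums w Ns alpha q M : nonincr_weight w ->
  (forall n, (0 < n)%N -> alpha n ^+ 2 = 1) -> white_noise w Ns alpha ->
  (0 < q)%N -> (0 < M)%N ->
  exists k0, forall k, (k0 <= k)%N ->
    \sum_(1 <= n < (Ns k).+1) w n * (\sum_(m < M) alpha (n + q * m)%N) ^+ 2 <=
      2 * M%:R * total_weight w (Ns k).
Proof.
move=> [w0 _] alpha1 white q0 M0.
have corr (i : 'I_M * 'I_M) : exists k0, forall k, (k0 <= k)%N ->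
    \sum_(1 <= n < (Ns k).+1)
      w n * (alpha (n + q * i.1)%N * alpha (n + q * i.2)%N) <=
    ((i.1 == i.2)%:R + M%:R^-1) * total_weight w (Ns k).
  case: i => i j /=; have [<-|nij] := eqVneq i j.
    exists 0%N => k _; rewrite (eq_big_nat _ _ (F2 := w)) => [|n /andP[n0 _]].
      rewrite -/(total_weight w _) mulrDl mul1r lerDl mulr_ge0 ?invr_ge0 //.
      by rewrite /total_weight big_nat_cond sumr_ge0 // => n /andP[/andP[/w0]].
    by rewrite -expr2 alpha1 ?mulr1 // addn_gt0 n0.
  have [||k0 Hk0] := white (q * i)%N (q * j)%N _ M%:R^-1.
  - by rewrite eqn_pmul2l.
  - by rewrite invr_gt0 ltr0n.
  by exists k0 => k /Hk0; rewrite add0r; apply: le_trans; exact: ler_norm.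
have {corr} [k0 Hk0] := choice corr.
exists (\sum_i k0 i)%N => k kk0.
under eq_bigr do rewrite expr2 mulr_suml mulr_sumr.
rewrite exchange_big /=.
apply: (@le_trans _ _ (\sum_(i < M) \sum_(j < M)
   ((i == j)%:R + M%:R^-1) * total_weight w (Ns k))).
  apply: ler_sum => i _; under eq_bigr do rewrite !mulr_sumr.
  rewrite exchange_big /=; apply: ler_sum => j _.
  apply: (Hk0 (i, j)); apply: leq_trans kk0.
  by rewrite (bigD1 (i, j)) //= leq_addr.
under eq_bigr do rewrite -mulr_suml.
rewrite -mulr_suml le_eqVlt; apply/orP; left; apply/eqP; congr (_ * _).
rewrite (eq_bigr (fun => 2)) => [|i _].
  by rewrite sumr_const card_ord mulr_natr.
rewrite big_split /= (bigD1 i) //= eqxx big1 => [|j]; last first.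
  by rewrite eq_sym => /negPf ->.
rewrite addr0 sumr_const card_ord -[_ *+ M]mulr_natr mulVf //.
by rewrite pnatr_eq0 -lt0n.
Qed.

(** Average over the translates by [q m] for [m < M]. Replacing [F (n + q m)]
    by [F n] leaves the sums of [alpha] over progressions of length [M], and
    these have size [sqrt M] in quadratic mean. *)
Lemma white_noise_orthogonal w Ns alpha F : nonincr_weight w ->
  weight_diverges w Ns ->
  (forall n, (0 < n)%N -> alpha n ^+ 2 = 1) -> white_noise w Ns alpha ->
  (forall n, (0 < n)%N -> cmod (F n) <= 1) -> mean_almost_periodic w F ->
  forall eps : R, 0 < eps -> exists k0, forall k, (k0 <= k)%N ->
    cmod (\sum_(1 <= n < (Ns k).+1) (w n)%:C * ((alpha n)%:C * F n)) <=
      eps * total_weight w (Ns k).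
Proof.
move=> wP Winf alpha1 white F1 Fap eps eps0.
have w0 := wP.1.
have e4 : 0 < eps / 4 by rewrite divr_gt0.
have [q q0 /choice[C HC]] := Fap _ e4.
(* [T] is the order of the root mean square of a sum of [M] values of
   [alpha]. *)
pose T := (Num.bound (6 / eps)).+1; pose M := (T * T)%N.
have TR : 6 / eps <= T%:R.
  apply: le_trans (ltW (archi_boundP _)) _; first by rewrite divr_ge0 // ltW.
  by rewrite ler_nat.
have T0 : 0 < T%:R :> R by rewrite ltr0n.
have M0 : (0 < M)%N by rewrite muln_gt0.
pose C' := \sum_(m < M) (2 * 1 * w 1%N * (q * m)%:R + C m).
have [k1 Hk1] := white_noise_sums wP alpha1 white q0 M0.
have [k2 Hk2] := Winf (C' / (eps / 4)).
exists (k1 + k2)%N => k kk.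
have {Hk1} Hb := Hk1 k (leq_trans (leq_addr _ _) kk).
have {Hk2} := Hk2 k (leq_trans (leq_addl _ _) kk).
rewrite ler_pdivrMr // mulrC => HW.
move: Hb HW; set N := Ns k; set W := total_weight w N => Hb HW.
have W0 : 0 <= W.
  by rewrite /W /total_weight big_nat_cond sumr_ge0 // => n /andP[/andP[/w0]].
have alphaN n : (0 < n)%N -> `|alpha n| = 1.
  move=> n0; apply/eqP; rewrite -(@pexpr_eq1 _ _ 2) // real_normK ?num_real //.
  by rewrite alpha1.
pose x n := (alpha n)%:C * F n; rewrite -/(x _).
have x1 n : (0 < n)%N -> cmod (x n) <= 1.
  by move=> n0; rewrite cmodM cmod_real alphaN // mul1r F1.
set X := \sum_(_ <= n < _) _.
pose b n := \sum_(m < M) alpha (n + q * m)%N.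
pose Y := \sum_(1 <= n < N.+1) (w n)%:C * ((b n)%:C * F n).
have step m : cmod (X - \sum_(1 <= n < N.+1)
    (w n)%:C * ((alpha (n + q * m)%N)%:C * F n)) <=
    2 * 1 * w 1%N * (q * m)%:R + C m + eps / 4 * W.
  have h1 := weighted_shift N (q * m) wP x1.
  have h2 : cmod (\sum_(1 <= n < N.+1) (w n)%:C * x (n + q * m)%N -
      \sum_(1 <= n < N.+1) (w n)%:C * ((alpha (n + q * m)%N)%:C * F n)) <=
      eps / 4 * W + C m.
    apply: le_trans (HC m N); rewrite -sumrB; apply: le_trans (cmod_sum _ _ _) _.
    rewrite big_nat_cond [leRHS]big_nat_cond; apply: ler_sum => n.
    rewrite andbT => /andP[n0 _].
    rewrite /x -mulrBr -mulrBr !cmodM !cmod_real alphaN ?addn_gt0 ?n0 // mul1r.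
    by rewrite ger0_norm ?w0.
  rewrite cmod_distC in h1.
  set X' := \sum_(_ <= n < _) _ * x (n + _)%N in h1 h2.
  rewrite -(subrK X' X) -addrA; apply: le_trans (cmodD _ _) _.
  by rewrite -/X in h1; lra.
have sumY : \sum_(m < M) \sum_(1 <= n < N.+1)
    (w n)%:C * ((alpha (n + q * m)%N)%:C * F n) = Y.
  rewrite exchange_big /=; apply: eq_bigr => n _.
  by rewrite -mulr_sumr -mulr_suml /b rmorph_sum.
have HX : M%:R * cmod X <= C' + M%:R * (eps / 4 * W) + cmod Y.
  have -> : M%:R * cmod X = cmod (M%:R * X).
    rewrite cmodM; congr (_ * _).
    by rewrite -(rmorph_nat (real_complex R)) cmod_real ger0_norm.
  have -> : M%:R * X = \sum_(m < M) (X - \sum_(1 <= n < N.+1)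
      (w n)%:C * ((alpha (n + q * m)%N)%:C * F n)) + Y.
    by rewrite sumrB sumY sumr_const card_ord mulr_natl subrK.
  apply: le_trans (cmodD _ _) _; rewrite lerD2r.
  apply: le_trans (cmod_sum _ _ _) _.
  apply: (@le_trans _ _ (\sum_(m < M)
      (2 * 1 * w 1%N * (q * m)%:R + C m + eps / 4 * W))).
    by apply: ler_sum => m _; exact: step.
  by rewrite big_split /= sumr_const card_ord -[_ *+ M]mulr_natl.
have HY : cmod Y <= 3 / 2 * T%:R * W.
  apply: le_trans (cmod_sum _ _ _) _.
  apply: (@le_trans _ _ (\sum_(1 <= n < N.+1)
     (w n * b n ^+ 2 / (2 * T%:R) + T%:R / 2 * w n))).
    rewrite big_nat_cond [leRHS]big_nat_cond; apply: ler_sum => n.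
    rewrite andbT => /andP[n0 _].
    rewrite !cmodM !cmod_real ger0_norm ?w0 //.
    have -> : w n * b n ^+ 2 / (2 * T%:R) + T%:R / 2 * w n =
      w n * (`|b n| ^+ 2 / (2 * T%:R) + T%:R / 2).
      by rewrite real_normK ?num_real //; ring.
    rewrite ler_wpM2l ?w0 //.
    apply: (@le_trans _ _ `|b n|); first by rewrite ler_piMr // F1.
    move: (`|b n|) => v; rewrite -subr_ge0.
    have -> : v ^+ 2 / (2 * T%:R) + T%:R / 2 - v = (v - T%:R) ^+ 2 / (2 * T%:R).
      by field; rewrite gt_eqF.
    by rewrite divr_ge0 ?sqr_ge0 // mulr_ge0.
  rewrite big_split /= -mulr_suml -mulr_sumr -/(total_weight w N) -/W.
  have : (\sum_(1 <= n < N.+1) w n * b n ^+ 2) / (2 * T%:R) <= T%:R * W.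
    rewrite ler_pdivrMr ?mulr_gt0 //; apply: le_trans Hb _.
    by rewrite /M natrM le_eqVlt; apply/orP; left; apply/eqP; ring.
  by lra.
have MR : 0 < M%:R :> R by rewrite ltr0n.
rewrite -(ler_pM2l MR); apply: le_trans HX _.
have h1 : 3 / 2 * T%:R * W <= M%:R * (eps / 4 * W).
  rewrite [leRHS]mulrA ler_wpM2r // /M natrM.
  rewrite ler_pdivrMr // in TR.
  by have := ler_wpM2l (ltW T0) TR; lra.
have h2 : C' <= M%:R * (eps / 4 * W).
  apply: le_trans HW _; apply: ler_peMl; last by rewrite ler1n.
  by rewrite mulr_ge0 // ltW.
have h3 : 0 <= M%:R * (eps / 4 * W) by rewrite !mulr_ge0 // ltW.
have -> : M%:R * (eps * W) = 4 * (M%:R * (eps / 4 * W)) by field.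
by move: (M%:R * (eps / 4 * W)) h1 h2 h3 => Z; lra.
Qed.

End Orthogonality.

(** * Chowla-Elliott averages *)

Section ChowlaElliott.
Variable R : realType.
Implicit Types (w alpha : nat -> R) (F a f : nat -> R[i]) (S : seq nat).

(** The common form of the two averaging operators. *)
Definition weighted_avg w (E : nat -> (nat -> R[i]) -> R[i]) :=
  forall N x, E N x =
    ((total_weight w N)^-1)%:C * \sum_(1 <= n < N.+1) (w n)%:C * x n.

Lemma cvg0_cmodP (u : nat -> R[i]) :
  ((u : nat -> R[i]^o) @ \oo --> (0 : R[i]^o))%classic <->
  forall eps : R, 0 < eps ->
    exists k0, forall k, (k0 <= k)%N -> cmod (u k) <= eps.
Proof.
split => [/cvgrPdist_lt u0 eps eps0|u0].
  have /u0[k0 _ Hk0] : 0 < eps%:C by rewrite ltcR.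
  exists k0 => k /Hk0 /=.
  by rewrite sub0r normrN normr_cmod ltcR => /ltW.
apply/cvgrPdist_lt => -[e e'] e0.
have [e'0 {}e0] : e' = 0 /\ 0 < e by move: e0; rewrite ltcE /= => /andP[/eqP].
have /u0[k0 Hk0] : 0 < e / 2 by rewrite divr_gt0.
exists k0 => // k /= /Hk0; rewrite sub0r normrN normr_cmod e'0 ltcR => h.
by apply: le_lt_trans h _; lra.
Qed.

Lemma weighted_avg_cvg0 w Ns E (x : nat -> R[i]) : weighted_avg w E ->
  (forall k, 0 < total_weight w (Ns k)) ->
  ((fun k => E (Ns k) x : R[i]^o) @ \oo --> (0 : R[i]^o))%classic <->
  forall eps : R, 0 < eps -> exists k0, forall k, (k0 <= k)%N ->
    cmod (\sum_(1 <= n < (Ns k).+1) (w n)%:C * x n) <=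
      eps * total_weight w (Ns k).
Proof.
move=> wE W0; have EE k eps : (cmod (E (Ns k) x) <= eps) =
    (cmod (\sum_(1 <= n < (Ns k).+1) (w n)%:C * x n) <=
      eps * total_weight w (Ns k)).
  rewrite wE cmodM cmod_real ger0_norm; last by rewrite invr_ge0 ltW.
  by rewrite mulrC ler_pdivrMr.
rewrite cvg0_cmodP; split => H eps /H[k0 Hk0]; exists k0 => k /Hk0;
  by rewrite EE.
Qed.

Lemma chowla_seq (E : nat -> (nat -> R[i]) -> R[i]) Ns a S :
  chowla_elliott E Ns a -> uniq S -> S != [::] ->
  ((fun k => E (Ns k) (fun n => \prod_(x <- S) a (n + x)%N) : R[i]^o)
    @ \oo --> (0 : R[i]^o))%classic.
Proof.
move=> H uS S0.
have inj : injective (fun i : 'I_(size S) => nth 0%N S i).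
  move=> i j /eqP; rewrite nth_uniq // => /eqP; exact: val_inj.
have := H (size S) (fun i => nth 0%N S i) (fun _ => false) _ inj.
rewrite lt0n size_eq0 => /(_ S0).
rewrite [X in (X @ \oo --> _)%classic -> _](_ : _ =
  fun k => E (Ns k) (fun n => \prod_(x <- S) a (n + x)%N)) //.
apply/funext => k; congr (E _ _); apply/funext => n.
by rewrite (big_nth 0%N) big_mkord.
Qed.

(** In the product of two different translates of a pattern [S] of shifts the
    common factors cancel, since [a ^ 2 = 1]; what is left is the pattern of
    the symmetric difference, which is not empty. *)
Lemma shift_pattern_symdiff S c c' : uniq S -> S != [::] -> c != c' ->
  exists L, [/\ uniq L, L != [::] &
    forall b : nat -> R[i], (forall n, b n ^+ 2 = 1) ->
      (\prod_(x <- S) b (c + x)%N) * (\prod_(x <- S) b (c' + x)%N) =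
      \prod_(x <- L) b x].
Proof.
move=> uS S0 cc'.
pose S1 := map (addn c) S; pose S2 := map (addn c') S.
have u1 : uniq S1 by rewrite map_inj_uniq //; exact: addnI.
have u2 : uniq S2 by rewrite map_inj_uniq //; exact: addnI.
exists ([seq x <- S1 | x \notin S2] ++ [seq x <- S2 | x \notin S1]); split.
- rewrite cat_uniq !filter_uniq // andbT /=; apply/hasPn => x.
  by rewrite !mem_filter => /andP[/negPf -> _]; rewrite andbF.
- apply/negP => /eqP Lnil.
  have sub1 x : x \in S1 -> x \in S2.
    move=> x1; apply/negPn/negP => x2.
    have : x \in [::] by rewrite -Lnil mem_cat mem_filter x1 x2.
    by rewrite in_nil.
  have sub2 x : x \in S2 -> x \in S1.
    move=> x2; apply/negPn/negP => x1.
    have : x \in [::] by rewrite -Lnil mem_cat !mem_filter x1 x2 orbT.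
    by rewrite in_nil.
  (* Equal translates would have equal sums, forcing [c = c']. *)
  have /perm_sumn : perm_eq S1 S2.
    by apply: uniq_perm => // x; apply/idP/idP; [exact: sub1|exact: sub2].
  rewrite !sumnE !big_map !big_split /= !big_const_seq !count_predT !iter_addn_0.
  move=> /addIn/eqP; rewrite eqn_mul2r size_eq0 (negPf S0) /=.
  by rewrite (negPf cc').
move=> b b2; rewrite big_cat /= !big_filter.
rewrite -[\prod_(x <- S) b (c + x)%N](big_map (addn c) xpredT b) -/S1.
rewrite -[\prod_(x <- S) b (c' + x)%N](big_map (addn c') xpredT b) -/S2.
rewrite (bigID (fun x => x \in S2)) /= [\prod_(x <- S2) _](bigID (fun x => x \in S1)) /=.
have -> : \prod_(x <- S2 | x \in S1) b x = \prod_(x <- S1 | x \in S2) b x.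
  rewrite -big_filter -[RHS]big_filter; apply: perm_big; apply: uniq_perm.
  - by rewrite filter_uniq.
  - by rewrite filter_uniq.
  - by move=> x; rewrite !mem_filter andbC.
have : (\prod_(x <- S1 | x \in S2) b x) ^+ 2 = 1.
  by rewrite -prodrXl big1.
move: (\prod_(x <- S1 | x \in S2) b x) (\prod_(x <- S1 | x \notin S2) b x)
  (\prod_(x <- S2 | x \notin S1) b x) => P Q Q' P2.
have -> : P * Q * (P * Q') = P ^+ 2 * (Q * Q') by ring.
by rewrite P2 mul1r.
Qed.

Lemma sign_pow_cmod eps (z : R[i]) : cmod (sign_pow eps z) = cmod z.
Proof. by case: eps => //=; rewrite cmod_conj. Qed.

Lemma sign_powB eps (z z' : R[i]) :
  sign_pow eps z - sign_pow eps z' = sign_pow eps (z - z').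
Proof. by case: eps => //=; rewrite rmorphB. Qed.

Lemma sign_powM eps (z z' : R[i]) :
  sign_pow eps (z * z') = sign_pow eps z * sign_pow eps z'.
Proof. by case: eps => //=; rewrite rmorphM. Qed.

Lemma chowla_white_noise w Ns E a S : weighted_avg w E ->
  (forall k, 0 < total_weight w (Ns k)) ->
  (forall n, (0 < n)%N -> a n = 1 \/ a n = -1) ->
  chowla_elliott E Ns a -> uniq S -> S != [::] ->
  white_noise w Ns (fun n => complex.Re (\prod_(x <- S) a (n + x)%N)).
Proof.
move=> wE W0 a1 chow uS S0 c c' cc' eps eps0.
have [L [uL L0 HL]] := shift_pattern_symdiff uS S0 cc'.
have /(weighted_avg_cvg0 _ wE W0)/(_ eps eps0)[k0 Hk0] := chowla_seq chow uL L0.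
exists k0 => k /Hk0.
rewrite -cmod_real rmorph_sum /=.
rewrite [X in cmod X <= _ -> _](_ : _ = \sum_(1 <= n < (Ns k).+1)
   (w n * (complex.Re (\prod_(x <- S) a (n + c + x)%N) *
           complex.Re (\prod_(x <- S) a (n + c' + x)%N)))%:C) //.
apply: eq_big_nat => n /andP[n0 _].
have an x : a (n + x)%N = 1 \/ a (n + x)%N = -1 by apply: a1; rewrite addn_gt0 n0.
have realprod d : (complex.Re (\prod_(x <- S) a (n + d + x)%N))%:C =
    \prod_(x <- S) a (n + (d + x))%N.
  rewrite (eq_bigr (fun x => a (n + (d + x))%N)) => [|x _]; last by rewrite addnA.
  elim/big_rec: _ => [//|x z _]; move: z => [u v] /= [<-].
  by case: (an (d + x)%N) => -> /=; simpc.
rewrite !rmorphM /= !realprod -(HL (fun x => a (n + x)%N)) //.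
by move=> x; case: (an x) => ->; rewrite ?sqrrN expr1n.
Qed.

(** Products of translates of [f] inherit almost periodicity from [f]; the
    passage to other weights is by summation by parts. *)
Lemma shifted_product_almost_periodic w f l (shift : 'I_l -> nat) eps :
  nonincr_weight w -> (0 < l)%N -> disc_valued f ->
  multiplicative_fun f -> pretentious f ->
  mean_almost_periodic w
    (fun n => \prod_(i < l) sign_pow (eps i) (f (n + shift i)%N)).
Proof.
move=> wP l0 fd fM fp e e0.
have lR : 0 < l%:R :> R by rewrite ltr0n.
have [q q0 Hq] := pretentious_almost_periodic fd fM fp (divr_gt0 e0 lR).
exists q => // m; have [C HC] := Hq m.
exists (\sum_(i < l) (C * w 1%N + 2 * 2 * w 1%N * (shift i)%:R)) => N.
have fc n : (0 < n)%N -> cmod (f n) <= 1 by move=> n0; rewrite -cmod_le1 fd.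
pose x n := cmod (f (n + q * m)%N - f n).
have x2 n : (0 < n)%N -> `|x n| <= 2.
  move=> n0; rewrite ger0_norm ?cmod_ge0 //.
  apply: le_trans (cmodB _ _) _.
  by have := fc n n0; have := fc (n + q * m)%N; rewrite addn_gt0 n0 => /(_ isT); lra.
apply: (@le_trans _ _ (\sum_(1 <= n < N.+1) w n * \sum_(i < l) x (n + shift i)%N)).
  rewrite big_nat_cond [leRHS]big_nat_cond; apply: ler_sum => n.
  rewrite andbT => /andP[n0 _]; rewrite ler_wpM2l ?wP.1 //.
  apply: le_trans (cmod_prod_dist _) _ => [i _|].
    by rewrite !sign_pow_cmod !fc // !addn_gt0 n0.
  apply: ler_sum => i _; rewrite sign_powB sign_pow_cmod.
  by rewrite /x addnAC.
under eq_bigr do rewrite mulr_sumr.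
rewrite exchange_big /=.
apply: (@le_trans _ _ (\sum_(i < l) (e / l%:R * total_weight w N +
    (C * w 1%N + 2 * 2 * w 1%N * (shift i)%:R)))).
  apply: ler_sum => i _; apply: le_trans (weighted_shift_real N (shift i) wP x2) _.
  by rewrite addrA lerD2r; exact: abel_sum_le.
rewrite big_split /= lerD2r sumr_const card_ord -[_ *+ l]mulr_natr.
by rewrite mulrAC divfK // gt_eqF.
Qed.

Theorem chowla_elliott_mul_pretentious w Ns E a f :
  nonincr_weight w -> weight_diverges w Ns ->
  (forall k, 0 < total_weight w (Ns k)) -> weighted_avg w E ->
  (forall n, (0 < n)%N -> a n = 1 \/ a n = -1) ->
  disc_valued f -> multiplicative_fun f -> pretentious f ->
  chowla_elliott E Ns a -> chowla_elliott E Ns (fun n => a n * f n).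
Proof.
move=> wP Winf W0 wE a1 fd fM fp chow l shift eps l0 shift_inj.
pose S := [seq shift i | i <- enum 'I_l].
have uS : uniq S by rewrite map_inj_uniq // enum_uniq.
have S0 : S != [::] by rewrite -size_eq0 size_map size_enum_ord -lt0n.
pose A n := \prod_(x <- S) a (n + x)%N.
have AE n : A n = \prod_(i < l) a (n + shift i)%N.
  by rewrite /A big_map big_enum.
have white := chowla_white_noise wE W0 a1 chow uS S0.
have an n x : (0 < n)%N -> a (n + x)%N = 1 \/ a (n + x)%N = -1.
  by move=> n0; apply: a1; rewrite addn_gt0 n0.
have ARe n : (0 < n)%N -> A n = 1 \/ A n = -1.
  move=> n0; rewrite /A; elim/big_rec: _ => [|x z _]; first by left.
  by case: (an n x n0) => -> [] ->; rewrite ?mulrNN ?mulr1 ?mul1r; [left|right|right|left].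
apply/(weighted_avg_cvg0 _ wE W0).
pose F n := \prod_(i < l) sign_pow (eps i) (f (n + shift i)%N).
have F1 n : (0 < n)%N -> cmod (F n) <= 1.
  move=> n0; apply: cmod_prod_le1 => i _.
  by rewrite sign_pow_cmod -cmod_le1 fd // addn_gt0 n0.
have Fap := shifted_product_almost_periodic shift eps wP l0 fd fM fp.
have alpha1 n : (0 < n)%N -> complex.Re (A n) ^+ 2 = 1.
  by move=> /ARe[] -> /=; rewrite ?sqrrN expr1n.
move=> e e0.
have [k0 Hk0] := white_noise_orthogonal wP Winf alpha1 white F1 Fap e0.
exists k0 => k /Hk0.
rewrite [X in cmod X <= _ -> _](_ : _ = \sum_(1 <= n < (Ns k).+1) (w n)%:C *
   \prod_(i < l) sign_pow (eps i) (a (n + shift i)%N * f (n + shift i)%N)) //.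
apply: eq_big_nat => n /andP[n0 _]; congr (_ * _).
rewrite (eq_bigr (fun i => a (n + shift i)%N *
    sign_pow (eps i) (f (n + shift i)%N))) => [|i _].
  rewrite big_split /= -AE; congr (_ * _).
  by case: (ARe n n0) => -> /=; simpc.
rewrite sign_powM; congr (_ * _).
case: (eps i) => //=; case: (an n (shift i) n0) => ->; rewrite ?rmorphN.
  exact: conjc1.
by congr (- _); exact: conjc1.
Qed.

End ChowlaElliott.

(** * Cesaro and logarithmic weights *)

Section Weights.
Variable R : realType.

Lemma nonincr_weight_1 : nonincr_weight (fun=> 1 : R).
Proof. by []. Qed.

Lemma total_weight_1 N : total_weight (fun=> 1 : R) N = N%:R.
Proof. by rewrite /total_weight sumr_const_nat subn1. Qed.

Lemma cesaro_weighted_avg : weighted_avg (fun=> 1 : R) (@cesaro_avg R).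
Proof.
move=> N x; rewrite total_weight_1 /cesaro_avg fmorphV rmorph_nat.
by under [in RHS]eq_bigr do rewrite mul1r.
Qed.

Lemma nonincr_weight_log : nonincr_weight (fun n => n%:R^-1 : R).
Proof.
split=> n n0; first by rewrite invr_ge0.
by rewrite lef_pV2 ?posrE ?ltr0n // ler_nat.
Qed.

Lemma log_weighted_avg : weighted_avg (fun n => n%:R^-1 : R) (@log_avg R).
Proof.
move=> N x; rewrite /log_avg /total_weight fmorphV rmorph_sum /=.
congr (_^-1 * _).
  by apply: eq_bigr => n _; rewrite fmorphV rmorph_nat.
by apply: eq_bigr => n _; rewrite fmorphV rmorph_nat mulrC.
Qed.

Lemma leq_incr_seq (Ns : nat -> nat) :
  (forall j k, (j < k)%N -> (Ns j < Ns k)%N) -> forall k, (k <= Ns k)%N.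
Proof. by move=> incr; elim=> // k IH; apply: leq_ltn_trans IH (incr _ _ _). Qed.

Lemma weight_diverges_along (w : nat -> R) Ns :
  (forall n, (0 < n)%N -> 0 <= w n) ->
  (forall A, exists N, A <= total_weight w N) ->
  (forall j k, (j < k)%N -> (Ns j < Ns k)%N) -> weight_diverges w Ns.
Proof.
move=> w0 winf incr A; have [N AN] := winf A.
exists N => k Nk; apply: le_trans AN _.
have NNk := leq_trans Nk (leq_incr_seq incr k).
rewrite /total_weight [leRHS](@big_cat_nat _ _ _ N.+1) //= lerDl.
rewrite big_nat_cond sumr_ge0 // => n /andP[/andP[Nn _] _].
by rewrite w0 // (leq_trans _ Nn).
Qed.

Lemma total_weight_1_unbounded (A : R) : exists N, A <= total_weight (fun=> 1 : R) N.
Proof.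
exists (Num.bound `|A|); rewrite total_weight_1.
exact: le_trans (ler_norm A) (ltW (archi_boundP (normr_ge0 A))).
Qed.

Lemma total_weight_log_unbounded (A : R) :
  exists N, A <= total_weight (fun n => n%:R^-1 : R) N.
Proof.
apply: contrapT => /forallNP bounded; apply: (@dvg_harmonic R).
(* [harmonic] is indexed from 0, hence the shift by one. *)
have harmE N : series (@harmonic R) N = total_weight (fun n => n%:R^-1) N.
  by rewrite /total_weight big_add1.
apply: nondecreasing_is_cvgn.
  apply/nondecreasing_seqP => n; rewrite /series /= big_nat_recr //= lerDl.
  exact: harmonic_ge0.
exists A => _ [N _ <-]; rewrite harmE ltW // ltNge.
by apply/negP; exact: bounded.
Qed.

End Weights.

Theorem theorem2p16 (R : realType) (N : nat -> nat) (a f : nat -> R[i])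
  (N_pos : forall k, (0 < N k)%N)
  (N_incr : forall j k, (j < k)%N -> (N j < N k)%N)
  (a_pm1 : forall n, (0 < n)%N -> a n = 1 \/ a n = -1)
  (f_disc : disc_valued f)
  (f_mult : multiplicative_fun f)
  (f_pret : pretentious f) :
  (chowla_elliott (@cesaro_avg R) N a ->
   chowla_elliott (@cesaro_avg R) N (fun n => a n * f n)) /\
  (chowla_elliott (@log_avg R) N a ->
   chowla_elliott (@log_avg R) N (fun n => a n * f n)).
Proof.
split.
- apply: (chowla_elliott_mul_pretentious (nonincr_weight_1 R)) => //.
  + apply: weight_diverges_along => //; exact: total_weight_1_unbounded.
  + by move=> k; rewrite total_weight_1 ltr0n.
  + exact: cesaro_weighted_avg.
- apply: (chowla_elliott_mul_pretentious (nonincr_weight_log R)) => //.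
  + apply: weight_diverges_along => //; exact: total_weight_log_unbounded.
  + move=> k; rewrite /total_weight big_ltn ?ltnS ?N_pos // invr1.
    by rewrite ltr_wpDr ?ltr01 // sumr_ge0 // => n _; rewrite invr_ge0.
  + exact: log_weighted_avg.
Qed.
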